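(* Let $n\ge1$ and let $M$ be a compact manifold. Both the fibre-inclusion and projection maps in the fibration $$\mathrm{EC}(n,M)\to\mathrm{PEC}(n,M)\to\mathrm{EC}(n-1,M)$$ are maps of little $n$-cubes objects. The graphing map $$\mathrm{gr}_1:\Omega\,\mathrm{EC}(n-1,M)\to\mathrm{EC}(n,M),\qquad \mathrm{gr}_1(F)(t_0,t,v)=(t_0,F(t_0)(t,v)),\quad t_0\in\mathbb R,\ t\in\mathbb R^{n-1},\ v\in M,$$ is a map of little $(n+1)$-cubes objects.
   Context: $\mathbf I=[-1,1]$. Embedding spaces consist of smooth embeddings with the weak $C^\infty$-topology. $\mathrm{EC}(k,M)$ is the space of smooth embeddings $f:\mathbb R^k\times M\to\mathbb R^k\times M$ with $\{x:f(x)\ne x\}\subset\mathbf I^k\times M$; base-point the identity. $\mathrm{PEC}(n,M)$ is the space of smooth embeddings $f:\mathbb R^n\times M\to\mathbb R^n\times M$ with $\{x:f(x)\neq x\}\subset[-1,\infty)\times\mathbf I^{n-1}\times M$ for which there is $g\in\mathrm{EC}(n-1,M)$ with $f(t_1,\dots,t_n,m)=(t_1,g(t_2,\dots,t_n,m))$ whenever $t_1\ge1$; the projection is $f\mapsto g$, i.e. restriction to $\{1\}\times\mathbb R^{n-1}\times M$. $\Omega X$ is the space of smooth maps $\mathbb R\to X$ sending $\mathbb R\setminus\mathbf I$ to the base-point. A little $k$-cube is $L=l_1\times\cdots\times l_k:\mathbf I^k\to\mathbf I^k$ with each $l_i:\mathbf I\to\mathbf I$, $l_i(t)=a_it+b_i$,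 affine-linear and increasing ($0<a_i\le 1$). $\mathcal C_k(j)$ is the space of maps $\sqcup_{i=1}^j\mathbf I^k\to\mathbf I^k$, embeddings on the interior of the domain, whose restriction $L_i$ to the $i$th copy of $\mathbf I^k$ is a little $k$-cube; these form the operad of little $k$-cubes. A little cube acts via its affine-linear extension by $L.f=(L\times\mathrm{Id}_M)\circ f\circ(L^{-1}\times\mathrm{Id}_M)$. For a little $k$-cube $L_i=l_{i,1}\times\cdots\times l_{i,k}$, put $L_i^\pi=l_{i,1}\times\cdots\times l_{i,k-1}$ (drop the last coordinate) and $L_i^t=l_{i,k}(-1)$ (initial point in the last coordinate). Action of $(k+1)$-cubes on $\mathrm{EC}(k,M)$: $$\kappa_j(L_1,\dots,L_j,f_1,\dots,f_j)=L^\pi_{\sigma(1)}.f_{\sigma(1)}\circ\cdots\circ L^\pi_{\sigma(j)}.f_{\sigma(j)}$$ with $\sigma$ any permutation such that $L^t_{\sigma(1)}\le\cdots\le L^t_{\sigma(j)}$ ($\kappa_0$ gives the identity). With $k=n-1$ this is the $n$-cubes action on $\mathrm{EC}(n-1,M)$ and with $k=n$ the $(n+1)$-cubes action on $\mathrm{EC}(n,M)$. Action of $n$-cubes on $\mathrm{EC}(n,M)$ (concatenation): $(L_1,\dots,L_j,f_1,\dots,f_j)\mapsto L_1.f_1\circ\cdots\circ L_j.f_j$. Action of $n$-cubes on $\mathrm{PEC}(n,M)$: $\kappa_j(L_1,\dots,L_j,f_1,\dots,f_j)=L_{\sigma(1)}.f_{\sigma(1)}\circ\cdots\circ L_{\sigma(j)}.f_{\sigma(j)}$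 with $\sigma$ any permutation such that $L^t_{\sigma(1)}\le\cdots\le L^t_{\sigma(j)}$. Action of $(n+1)$-cubes on $\Omega\,\mathrm{EC}(n-1,M)$: write $L_i=L_i^\alpha\times L_i^\beta$ with $L_i^\alpha$ the projection on the first coordinate (a little $1$-cube) and $L_i^\beta$ the projection on the remaining $n$ coordinates; then $$\kappa'_i(L_1,\dots,L_i,f_1,\dots,f_i)=\kappa_i(L_1^\beta,\dots,L_i^\beta,L_1^\alpha.f_1,\dots,L_i^\alpha.f_i)=L^{\beta\pi}_{\sigma(1)}.L^\alpha_{\sigma(1)}.f_{\sigma(1)}\circ\cdots\circ L^{\beta\pi}_{\sigma(i)}.L^\alpha_{\sigma(i)}.f_{\sigma(i)},$$ where $L^\alpha_p.f_p=f_p\circ(L^\alpha_p)^{-1}$ is reparametrisation in the loop coordinate, $\kappa_i$ is the $n$-cubes action on $\mathrm{EC}(n-1,M)$ applied pointwise in the loop coordinate, and $\sigma$ is any permutation with $L^{\beta t}_{\sigma(1)}\le\cdots\le L^{\beta t}_{\sigma(i)}$.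
   Formalization: For n ≥ 2 the fibration part is false as written (PEC is unbounded along t_1, but cubes are ordered by, and L^π drops, the last coordinate); it is proved with one common coordinate c of R^n in both roles, for every c; n = 1 and the graphing part are literal. *)

(* Defs.v *)
From HB Require Import structures.
From mathcomp Require Import all_boot all_order all_fingroup all_algebra.
From mathcomp Require Import all_classical all_reals all_analysis.

Set Implicit Arguments.
Unset Strict Implicit.
Unset Printing Implicit Defensive.
Import Order.TTheory GRing.Theory Num.Theory.
Import numFieldNormedType.Exports.
Local Open Scope classical_set_scope.
Local Open Scope ring_scope.

Section Smoothness.
Context {R : realType} {V W : normedModType R}.

(* C^infinity on an open set O: every iterated directional derivative is
   differentiable at every point of O. *)
Definition smooth_on (O : set V) (f : V -> W) : Prop :=
  forall (s : seq V) (x : V), O x ->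
    differentiable (foldr (fun v g y => 'D_v g y) f s) x.

(* Smoothness at x of a map defined on a subset D which need not be open (here,
   a half-space): f agrees on D, near x, with a smooth map on an open set. *)
Definition smooth_at (D : set V) (f : V -> W) (x : V) : Prop :=
  exists (O : set V) (F : V -> W),
    [/\ open O, O x, smooth_on O F & forall y, O y -> D y -> f y = F y].

(* Directional derivative relative to D.  At a boundary point of a half-space
   it is the one-sided derivative along the directions transverse to the
   boundary; it is the usual derivative at interior points. *)
Definition derive_in (D : set V) (v : V) (f : V -> W) (x : V) : W :=
  lim ((fun h : R => h^-1 *: (f (x + h *: v) - f x)) @
         within [set h | D (x + h *: v)] (0 : R)^').

Definition iter_derive_in (D : set V) (s : seq V) (f : V -> W) : V -> W :=
  foldr (fun v g => derive_in D v g) f s.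

End Smoothness.

(* {x in R^m | x_0 >= 0}; all of R^0 when m = 0. *)
Definition half_space (R : realType) (m : nat) : set 'rV[R]_m :=
  [set x | forall i : 'I_m, val i = 0%N -> 0 <= x ord0 i].

Record chart (R : realType) (m : nat) (M : topologicalType) := Chart {
  chart_dom : set M;
  chart_fun : M -> 'rV[R]_m;
  chart_inv : 'rV[R]_m -> M }.

Definition is_chart (R : realType) (m : nat) (M : topologicalType)
    (phi : chart R m M) : Prop :=
  [/\ open (chart_dom phi),
      exists2 O : set 'rV[R]_m, open O &
        chart_fun phi @` chart_dom phi = O `&` @half_space R m,
      {within chart_dom phi, continuous (chart_fun phi)},
      {within chart_fun phi @` chart_dom phi, continuous (chart_inv phi)} &
      forall x, chart_dom phi x -> chart_inv phi (chart_fun phi x) = x].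

(* Smooth m-dimensional manifolds, possibly with boundary. *)
Record manifold (R : realType) (m : nat) := Manifold {
  carrier :> topologicalType;
  atlas : set (chart R m carrier);
  manifold_hausdorff : hausdorff_space carrier;
  manifold_countable : @second_countable carrier;
  atlas_chart : forall phi, atlas phi -> is_chart phi;
  atlas_cover : forall x, exists2 phi, atlas phi & chart_dom phi x;
  atlas_smooth : forall phi psi x, atlas phi -> atlas psi ->
    chart_dom phi x -> chart_dom psi x ->
    smooth_at (@half_space R m) (chart_fun psi \o chart_inv phi)
      (chart_fun phi x) }.

Section EmbeddingSpaces.
Context {R : realType} {m : nat}.
Implicit Types M : manifold R m.

(* R^k x M carries the charts Id x phi, with values in R^k x R^m. *)
Notation model k := ('rV[R]_k * 'rV[R]_m)%type.

Definition model_dom (k : nat) : set (model k) :=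
  [set q | @half_space R m q.2].

Definition local_point k M (phi : chart R m M) (p : 'rV[R]_k * M) : model k :=
  (p.1, chart_fun phi p.2).

Definition local_rep k l M (phi psi : chart R m M)
    (f : 'rV[R]_k * M -> 'rV[R]_l * M) (q : model k) : model l :=
  local_point psi (f (q.1, chart_inv phi q.2)).

Definition smooth_map k l M (f : 'rV[R]_k * M -> 'rV[R]_l * M) : Prop :=
  continuous f /\
  forall (phi psi : chart R m M) (p : 'rV[R]_k * M),
    atlas phi -> atlas psi -> chart_dom phi p.2 -> chart_dom psi (f p).2 ->
    smooth_at (@model_dom k) (local_rep phi psi f) (local_point phi p).

Definition immersion k l M (f : 'rV[R]_k * M -> 'rV[R]_l * M) : Prop :=
  forall (phi psi : chart R m M) (p : 'rV[R]_k * M) (v : model k),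
    atlas phi -> atlas psi -> chart_dom phi p.2 -> chart_dom psi (f p).2 ->
    derive_in (@model_dom k) v (local_rep phi psi f) (local_point phi p) = 0 ->
    v = 0.

(* Homeomorphism onto the image. *)
Definition topological_embedding (X Y : topologicalType) (f : X -> Y) : Prop :=
  [/\ injective f, continuous f &
      forall O : set X, open O ->
        exists2 O' : set Y, open O' & f @` O = O' `&` range f].

Definition smooth_embedding k l M (f : 'rV[R]_k * M -> 'rV[R]_l * M) : Prop :=
  [/\ smooth_map f, immersion f & topological_embedding f].

(* Maps R^k x M -> R^l x M with the weak C^infinity (compact-open)
   topology.  It is put on all maps, and used only on subspaces of smooth
   maps. *)
Definition weak_map (k l : nat) M : Type := 'rV[R]_k * M -> 'rV[R]_l * M.

HB.instance Definition _ k l M := gen_eqMixin (weak_map k l M).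
HB.instance Definition _ k l M := gen_choiceMixin (weak_map k l M).

(* The basic neighbourhood N^r(f; phi, psi, K, e): the maps g with g(K) in the
   domain of psi whose local derivatives of order <= r are e-close to those of
   f over K.  The vectors in s range over the unit ball, so that the bound is
   on the operator norm of the (size s)-th derivative. *)
Definition weak_nbhd k l M (f : weak_map k l M) (phi psi : chart R m M)
    (K : set ('rV[R]_k * M)) (r : nat) (e : R) : set (weak_map k l M) :=
  [set g | forall p, K p -> chart_dom psi (g p).2 /\
    forall s : seq (model k), (size s <= r)%N -> all (fun v => `|v| <= 1) s ->
      `| iter_derive_in (@model_dom k) s (local_rep phi psi g)
           (local_point phi p)
       - iter_derive_in (@model_dom k) s (local_rep phi psi f)
           (local_point phi p) | < e].

Definition weak_subbase k l M : set (set (weak_map k l M)) :=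
  [set N | exists (f : weak_map k l M) (phi psi : chart R m M)
                  (K : set ('rV[R]_k * M)) (r : nat) (e : R),
    [/\ smooth_map f, atlas phi /\ atlas psi,
        compact K /\ 0 < e,
        forall p, K p -> chart_dom phi p.2 /\ chart_dom psi (f p).2 &
        N = weak_nbhd f phi psi K r e]].

HB.instance Definition _ k l M :=
  @isSubBaseTopological.Build (weak_map k l M)
    (set (weak_map k l M)) (@weak_subbase k l M) id.

Definition unit_cube (k : nat) : set 'rV[R]_k :=
  [set t | forall i, -1 <= t ord0 i <= 1].

Definition EC (k : nat) M : set (weak_map k k M) :=
  [set f | smooth_embedding f /\
    forall p, f p <> p -> unit_cube p.1].

(* The point of R^(n+1) with c-th coordinate x and other coordinates t;
   [col' c] removes the c-th coordinate. *)
Definition insert_coord n (c : 'I_n.+1) (x : R) (t : 'rV[R]_n) : 'rV[R]_n.+1 :=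
  \row_i (if unlift c i is Some j then t ord0 j else x).

(* The pseudo-isotopy coordinate c must be the one along which the cubes acting
   on PEC are ordered (see [PEC_operation]): with different coordinates the
   result would depend on the choice of the ordering permutation, and the
   projection would not be equivariant. *)
Definition PEC (n : nat) (c : 'I_n.+1) M : set (weak_map n.+1 n.+1 M) :=
  [set f | [/\ smooth_embedding f,
    (forall p, f p <> p ->
       -1 <= p.1 ord0 c /\ unit_cube (col' c p.1)) &
    exists2 g : weak_map n n M, @EC n M g &
      forall (x : R) (t : 'rV[R]_n) (v : M), 1 <= x ->
        f (insert_coord c x t, v) =
        (insert_coord c x (g (t, v)).1, (g (t, v)).2)]].

(* Restriction to the hyperplane where the c-th coordinate is 1. *)
Definition PEC_proj (n : nat) (c : 'I_n.+1) M
    (f : weak_map n.+1 n.+1 M) : weak_map n n M :=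
  fun p => let q := f (insert_coord c 1 p.1, p.2) in (col' c q.1, q.2).

Definition family (n : nat) M : Type := R -> weak_map n n M.

Definition adjoint n M (F : family n M) : weak_map n.+1 n M :=
  fun p => F (p.1 ord0 ord0) (col' ord0 p.1, p.2).

HB.instance Definition _ n M := gen_eqMixin (family n M).
HB.instance Definition _ n M := gen_choiceMixin (family n M).

(* Families carry the weak C^infinity topology of their adjoints. *)
HB.instance Definition _ n M :=
  Topological.copy (family n M) (initial_topology (@adjoint n M)).

(* A map R -> EC(n, M) is smooth when its adjoint R x R^n x M -> R^n x M is. *)
Definition loopEC (n : nat) M : set (family n M) :=
  [set F | [/\ smooth_map (adjoint F), forall x, @EC n M (F x) &
               forall x, ~ (-1 <= x <= 1) -> F x = id]].

Definition graphing n M (F : family n M) : weak_map n.+1 n.+1 M :=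
  fun p => let x := p.1 ord0 ord0 in let q := F x (col' ord0 p.1, p.2) in
           (insert_coord ord0 x q.1, q.2).

End EmbeddingSpaces.

Arguments EC {R m} k M.
Arguments PEC {R m n} c M.
Arguments PEC_proj {R m n} c M f.
Arguments loopEC {R m} n M.
Arguments graphing {R m n} M F.

Section LittleCubes.
Context {R : realType}.

Record little_cube (k : nat) := LittleCube {
  slope : 'I_k -> R;
  offset : 'I_k -> R;
  slope_bounds : forall i, 0 < slope i <= 1;
  little_cube_sub : forall i t, -1 <= t <= 1 ->
    -1 <= slope i * t + offset i <= 1 }.

Definition cube_fun k (L : little_cube k) (t : 'rV[R]_k) : 'rV[R]_k :=
  \row_i (slope L i * t ord0 i + offset L i).

Definition cube_inv k (L : little_cube k) (t : 'rV[R]_k) : 'rV[R]_k :=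
  \row_i ((t ord0 i - offset L i) / slope L i).

Definition face k (c : 'I_k.+1) (L : little_cube k.+1) : little_cube k :=
  LittleCube (fun i => slope_bounds L (lift c i))
             (fun i => @little_cube_sub _ L (lift c i)).

Definition initial k (c : 'I_k) (L : little_cube k) : R :=
  slope L c * (-1) + offset L c.

Definition open_cube (k : nat) : set 'rV[R]_k :=
  [set t | forall i, -1 < t ord0 i < 1].

(* C_k(j).  The L_i being affine with invertible linear part, they define an
   embedding of the disjoint union of the open cubes as soon as they define an
   injection. *)
Definition little_cubes k j (L : 'I_j -> little_cube k) : Prop :=
  forall (i i' : 'I_j) (s t : 'rV[R]_k), open_cube s -> open_cube t ->
    cube_fun (L i) s = cube_fun (L i') t -> i = i' /\ s = t.

(* [act j L x] is the set of the values kappa_j(L, x) obtained from all the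
   admissible choices of the permutation sigma. *)
Definition cubes_operation (k : nat) (T : Type) : Type :=
  forall j : nat, ('I_j -> little_cube k) -> ('I_j -> T) -> set T.

(* The maps kappa_j : C_k(j) x X^j -> X are well defined. *)
Definition cubes_action k (T : Type) (X : set T) (act : cubes_operation k T) :
    Prop :=
  forall (j : nat) (L : 'I_j -> little_cube k) (x : 'I_j -> T),
    little_cubes L -> (forall i, X (x i)) ->
    exists2 y, X y & act j L x = [set y].

(* Maps (X, act) -> (X', act') of little k-cubes objects. *)
Definition cubes_map k (T T' : topologicalType)
    (X : set T) (act : cubes_operation k T)
    (X' : set T') (act' : cubes_operation k T') (phi : T -> T') : Prop :=
  [/\ cubes_action X act /\ cubes_action X' act',
      forall x, X x -> X' (phi x),
      {within X, continuous phi} &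
      forall (j : nat) (L : 'I_j -> little_cube k) (x : 'I_j -> T),
        little_cubes L -> (forall i, X (x i)) ->
        phi @` act j L x = act' j L (phi \o x)].

Definition ordering j (key : 'I_j -> R) (s : {perm 'I_j}) : Prop :=
  forall a b : 'I_j, (a <= b)%N -> key (s a) <= key (s b).

(* f_(s 0) o ... o f_(s (j-1)) *)
Definition ordered_comp (T : Type) j (s : {perm 'I_j}) (f : 'I_j -> T -> T) :
    T -> T :=
  \big[(fun g h => g \o h)/id]_(i < j) f (s i).

End LittleCubes.

Section Actions.
Context {R : realType} {m : nat}.
Implicit Types M : manifold R m.

(* L.f *)
Definition cube_act k M (L : @little_cube R k) (f : weak_map k k M) :
    weak_map k k M :=
  fun p => let q := f (cube_inv L p.1, p.2) in (cube_fun L q.1, q.2).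

(* The (k+1)-cubes action on EC(k, M).  The cubes are ordered by their initial
   points along the coordinate c, and act through the other k coordinates. *)
Definition kappa (k : nat) (c : 'I_k.+1) M :
    @cubes_operation R k.+1 (weak_map k k M) :=
  fun j L f => [set g | exists2 s : {perm 'I_j},
    ordering (fun i => initial c (L i)) s &
    g = ordered_comp s (fun i => cube_act (face c (L i)) (f i))].

(* The k-cubes action on EC(k, M) by concatenation. *)
Definition concatenation (k : nat) M : @cubes_operation R k (weak_map k k M) :=
  fun j L f => [set ordered_comp 1%g (fun i => cube_act (L i) (f i))].

Definition PEC_operation (n : nat) (c : 'I_n.+1) M :
    @cubes_operation R n.+1 (weak_map n.+1 n.+1 M) :=
  fun j L f => [set g | exists2 s : {perm 'I_j},
    ordering (fun i => initial c (L i)) s &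
    g = ordered_comp s (fun i => cube_act (L i) (f i))].

(* L^alpha.F, where L^alpha is the first factor of L. *)
Definition loop_act k n M (L : @little_cube R k.+1) (F : family n M) :
    family n M :=
  fun x => F ((x - offset L ord0) / slope L ord0).

(* The (n+2)-cubes action on Omega EC(n, M); L^beta is [face ord0 L]. *)
Definition loop_operation (n : nat) M :
    @cubes_operation R n.+2 (family n M) :=
  fun j L F => [set G | exists2 s : {perm 'I_j},
    ordering (fun i => initial ord_max (face ord0 (L i))) s &
    G = fun x => ordered_comp s (fun i =>
      cube_act (face ord_max (face ord0 (L i))) (loop_act (L i) (F i) x))].

End Actions.

Arguments kappa {R m k} c M.
Arguments concatenation {R m} k M.
Arguments PEC_operation {R m n} c M.
Arguments loop_operation {R m} n M.

(* Main.v *)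
Require Import Defs.
From HB Require Import structures.
From mathcomp Require Import all_boot all_order all_fingroup all_algebra.
From mathcomp Require Import all_classical all_reals all_analysis.

Set Implicit Arguments.
Unset Strict Implicit.
Unset Printing Implicit Defensive.
Import Order.TTheory GRing.Theory Num.Theory.
Import numFieldNormedType.Exports.
Local Open Scope classical_set_scope.
Local Open Scope ring_scope.

(** An embedding is the identity off its support, which is an open set contained
    in a closed cube, hence in the open cube; therefore the maps L_i.f_i have
    disjoint supports, and commute, whenever the cubes through which they act
    have disjoint interiors.  This makes the value of an action independent of
    the ordering permutation: cubes with the same initial point along c overlap
    in the coordinate c, so their faces are disjoint.  Equivariance is then an
    identity between compositions, because a pseudo-isotopy is the graph of its
    restriction where t_1 >= 1, and graphing turns composition into composition.
    A graphed loop has compact support, so it is a closed map and a topological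
    embedding; it is an immersion because it preserves the slices t_0 = x and is
    an immersion on each of them.  For continuity, the derivatives of a graph
    split into a fixed part, along the graphed coordinate, and the derivatives
      of
    the map that is graphed: the relevant part of the preimage of a basic
    neighbourhood is again a basic neighbourhood. *)

(** * Differentials of locally equal functions and of products *)

Section NearDifferentiable.
Context {R : realType} {V W : normedModType R}.

(** The first-order expansion of f at x is also one of g, and uniqueness of the differential
    identifies ['d f x] with ['d g x]. *)
Lemma near_eq_differentiable (f g : V -> W) (x : V) :
  (\near x, f x = g x) -> differentiable f x -> differentiable g x.
Proof.
move=> fg df; have /diff_locallyP[dc /eqaddoP dE] := df.
apply/diff_locallyP.
have gE : g \o shift x = cst (g x) + 'd f x +o_ 0 id.
  apply/eqaddoP => e e0; have := dE e e0.
  have fgx : f x = g x := nbhs_singleton fg.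
  move: fg; rewrite (near_shift 0) /= => fg.
  apply: filterS2 fg => h /= E; rewrite /= subr0 in E.
  by rewrite !fctE /= E fgx.
by have [_ ->] := (diff_unique dc gE, diff_unique dc gE); split.
Qed.

End NearDifferentiable.

Section ScaleBilinear.
Context {R : realType} {V W : normedModType R}.

Fact scale_is_bilinear :
  bilinear_for
    (GRing.Scale.Law.clone _ _ *:%R _) (GRing.Scale.Law.clone _ _ *:%R _)
    (@GRing.scale R W : R^o -> W -> W).
Proof.
split=> [u'|u] a x y /=.
- by rewrite scalerDl scalerA.
- by rewrite scalerDr !scalerA mulrC.
Qed.

HB.instance Definition _ :=
  bilinear_isBilinear.Build R R^o W W _ _ (@GRing.scale R W : R^o -> W -> W)
    scale_is_bilinear.

(** The product rule, read off from the differential of the continuous bilinear map [*:%R] composed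
    with the pairing of k and f. *)
Lemma scale_derive (k : V -> R) (f : V -> W) (x v : V) :
  differentiable k x -> differentiable f x ->
  differentiable (fun y => k y *: f y) x /\
  'D_v (fun y => k y *: f y) x = k x *: 'D_v f x + 'D_v k x *: f x.
Proof.
move=> dk df.
have sc : continuous (fun p : R^o * W => p.1 *: p.2).
  by move=> p; exact: scale_continuous.
have db := @differentiable_bilin R R^o W W (@GRing.scale R W) (k x, f x) sc.
have dp : differentiable (fun y => (k y : R^o, f y)) x.
  exact: (@differentiable_pair _ _ R^o).
have dc := differentiable_comp dp db.
split; first exact: dc.
rewrite !deriveE //.
have -> : (fun y => k y *: f y) =
  (fun p : R^o * W => p.1 *: p.2) \o (fun y => (k y : R^o, f y)) by [].
rewrite diff_comp //= diff_bilin //= (@diff_pair _ _ R^o) //=.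
Qed.

End ScaleBilinear.

(** * Iterated directional derivatives and closure properties of smoothness *)

Section IteratedDerivative.
Context {R : realType} {V : normedModType R}.
Implicit Types W : normedModType R.

Definition iter_derive W (s : seq V) (f : V -> W) : V -> W :=
  foldr (fun v g y => 'D_v g y) f s.

(** The last entry of the list is the direction of the innermost derivative; inductions on the order
    peel off that one. *)
Lemma iter_derive_rcons W s v (f : V -> W) :
  iter_derive (rcons s v) f = iter_derive s (fun y => 'D_v f y).
Proof. by rewrite /iter_derive foldr_rcons. Qed.

(** The order n is the induction parameter for products and composites: their derivatives involve
    the original factors again, but one order lower. *)
Definition smooth_upto W (n : nat) (O : set V) (f : V -> W) :=
  forall (s : seq V) (x : V), (size s <= n)%N -> O x ->
    differentiable (iter_derive s f) x.

Lemma smooth_uptoP W (O : set V) (f : V -> W) :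
  smooth_on O f <-> forall n, smooth_upto n O f.
Proof.
split=> [fs n s x _|fs s x]; first exact: fs.
exact: fs (leqnn _).
Qed.

Lemma smooth_upto0 W (O : set V) (f : V -> W) :
  smooth_upto 0 O f <-> forall x, O x -> differentiable f x.
Proof.
split=> [fs x|fs s x]; first exact: (fs [::]).
by rewrite leqn0 => /nilP ->; exact: fs.
Qed.

Lemma smooth_uptoS W n (O : set V) (f : V -> W) :
  smooth_upto n.+1 O f <->
  (forall x, O x -> differentiable f x) /\
  forall v, smooth_upto n O (fun y => 'D_v f y).
Proof.
split=> [fs|[df fs]].
  split=> [x|v s x sn]; first exact: (fs [::]).
  by rewrite -iter_derive_rcons; apply: fs; rewrite size_rcons.
move=> s x; case/lastP: s => [_|s v]; first exact: df.
by rewrite size_rcons iter_derive_rcons; exact: fs.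
Qed.

Lemma smooth_uptoW W n (O : set V) (f : V -> W) :
  smooth_upto n.+1 O f -> smooth_upto n O f.
Proof. by move=> fs s x /leqW; exact: fs. Qed.

Lemma smooth_on_diff W (O : set V) (f : V -> W) x :
  smooth_on O f -> O x -> differentiable f x.
Proof. by move=> fs; exact: (fs [::]). Qed.

Lemma smooth_on_sub W (O O' : set V) (f : V -> W) :
  O' `<=` O -> smooth_on O f -> smooth_on O' f.
Proof. by move=> OO fs s x /OO; exact: fs. Qed.

Lemma iter_derive_eq W (O : set V) (f g : V -> W) s y :
  open O -> (forall x, O x -> f x = g x) -> O y ->
  iter_derive s f y = iter_derive s g y.
Proof.
move=> Oo; elim: s f g y => [|v s IHs] f g y fg Oy /=; first exact: fg.
apply: near_eq_derive; have := open_nbhs_nbhs (conj Oo Oy).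
by apply: filterS => z Oz; exact: IHs.
Qed.

Lemma smooth_upto_eq W n (O : set V) (f g : V -> W) :
  open O -> (forall x, O x -> f x = g x) ->
  smooth_upto n O f -> smooth_upto n O g.
Proof.
move=> Oo fg fs s x sn Ox; apply: near_eq_differentiable (fs s x sn Ox).
have := open_nbhs_nbhs (conj Oo Ox); apply: filterS => z Oz.
exact: iter_derive_eq fg Oz.
Qed.

Lemma smooth_upto_cst W n (O : set V) (a : W) : smooth_upto n O (cst a).
Proof.
elim: n a => [|n IHn] a; first by apply/smooth_upto0.
apply/smooth_uptoS; split=> // v.
rewrite (_ : (fun y => _) = cst 0) //.
by apply/funext => y; rewrite derive_cst.
Qed.

Lemma derive_linear W (A : {linear V -> W}) x v :
  continuous A -> 'D_v A x = A v.
Proof.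
by move=> Ac; rewrite (deriveE v (linear_differentiable x Ac)) diff_lin.
Qed.

Lemma smooth_on_linear W (A : {linear V -> W}) (O : set V) :
  continuous A -> smooth_on O A.
Proof.
move=> Ac; apply/smooth_uptoP => -[|n].
  by apply/smooth_upto0 => x _; exact: linear_differentiable.
apply/smooth_uptoS; split=> [x _|v]; first exact: linear_differentiable.
rewrite (_ : (fun y => _) = cst (A v)); first exact: smooth_upto_cst.
by apply/funext => y; rewrite derive_linear.
Qed.

Lemma derive_linear_comp W W' (A : {linear W -> W'}) (f : V -> W) x v :
  continuous A -> differentiable f x -> 'D_v (A \o f) x = A ('D_v f x).
Proof.
move=> Ac df; have dA := linear_differentiable (f x) Ac.
rewrite (deriveE v df) (deriveE v (differentiable_comp df dA)).
by rewrite (diff_comp df dA) /= (diff_lin _ Ac).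
Qed.

Lemma iter_derive_linear W W' (A : {linear W -> W'}) (O : set V) (f : V -> W) :
  continuous A -> open O -> smooth_on O f -> forall s x, O x ->
  iter_derive s (A \o f) x = A (iter_derive s f x).
Proof.
move=> Ac Oo fs; elim=> [//|v s IHs] x Ox /=.
rewrite -derive_linear_comp //; last exact: fs.
apply: near_eq_derive; have := open_nbhs_nbhs (conj Oo Ox).
by apply: filterS => z; exact: IHs.
Qed.

Lemma smooth_upto_linear_comp W W' (A : {linear W -> W'}) n (O : set V)
    (f : V -> W) :
  continuous A -> open O -> smooth_upto n O f -> smooth_upto n O (A \o f).
Proof.
move=> Ac Oo; elim: n f => [|n IHn] f.
  move=> /smooth_upto0 df; apply/smooth_upto0 => x Ox.
  exact: differentiable_comp (df x Ox) (linear_differentiable _ Ac).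
move=> /smooth_uptoS[df fs]; apply/smooth_uptoS; split=> [x Ox|v].
  exact: differentiable_comp (df x Ox) (linear_differentiable _ Ac).
apply: smooth_upto_eq (IHn _ (fs v)) => // x Ox.
by rewrite derive_linear_comp //; exact: df.
Qed.

Lemma smooth_on_linear_comp W W' (A : {linear W -> W'}) (O : set V)
    (f : V -> W) :
  continuous A -> open O -> smooth_on O f -> smooth_on O (A \o f).
Proof.
move=> Ac Oo /smooth_uptoP fs; apply/smooth_uptoP => n.
exact: smooth_upto_linear_comp.
Qed.

Lemma smooth_upto_add W n (O : set V) (f g : V -> W) : open O ->
  smooth_upto n O f -> smooth_upto n O g ->
  smooth_upto n O (fun y => f y + g y).
Proof.
move=> Oo; elim: n f g => [|n IHn] f g.
  move=> /smooth_upto0 df /smooth_upto0 dg; apply/smooth_upto0 => x Ox.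
  exact: differentiableD (df _ Ox) (dg _ Ox).
move=> /smooth_uptoS[df fs] /smooth_uptoS[dg gs]; apply/smooth_uptoS.
split=> [x Ox|v]; first exact: differentiableD (df _ Ox) (dg _ Ox).
apply: smooth_upto_eq (IHn _ _ (fs v) (gs v)) => // x Ox.
by rewrite -deriveD //; apply: diff_derivable; [exact: df|exact: dg].
Qed.

Lemma smooth_on_add W (O : set V) (f g : V -> W) : open O ->
  smooth_on O f -> smooth_on O g -> smooth_on O (fun y => f y + g y).
Proof.
move=> Oo /smooth_uptoP fs /smooth_uptoP gs; apply/smooth_uptoP => n.
exact: smooth_upto_add.
Qed.

Lemma smooth_upto_sum W n (O : set V) (I : finType) (f : I -> V -> W) :
  open O -> (forall i, smooth_upto n O (f i)) ->
  smooth_upto n O (fun y => \sum_i f i y).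
Proof.
move=> Oo fs; elim: (index_enum I) => [|i r IHr].
  rewrite (_ : (fun y => _) = cst 0); first exact: smooth_upto_cst.
  by apply/funext => y; rewrite big_nil.
rewrite (_ : (fun y => _) = fun y => f i y + \sum_(j <- r) f j y).
  exact: smooth_upto_add.
by apply/funext => y; rewrite big_cons.
Qed.

Lemma smooth_upto_scale W n (O : set V) (k : V -> R) (f : V -> W) : open O ->
  smooth_upto n O k -> smooth_upto n O f ->
  smooth_upto n O (fun y => k y *: f y).
Proof.
move=> Oo; elim: n k f => [|n IHn] k f.
  move=> /smooth_upto0 dk /smooth_upto0 df; apply/smooth_upto0 => x Ox.
  by have [] := scale_derive 0 (dk _ Ox) (df _ Ox).
move=> ks fs; have /smooth_uptoS[dk dks] := ks.
have /smooth_uptoS[df dfs] := fs; apply/smooth_uptoS.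
split=> [x Ox|v]; first by have [] := scale_derive 0 (dk _ Ox) (df _ Ox).
have kn := smooth_uptoW ks; have fn := smooth_uptoW fs.
apply: smooth_upto_eq (smooth_upto_add Oo (IHn _ _ kn (dfs v))
                                          (IHn _ _ (dks v) fn)) => // x Ox.
by have [_ ->] := scale_derive v (dk _ Ox) (df _ Ox).
Qed.

End IteratedDerivative.

Section Composition.
Context {R : realType} {U V W : normedModType R}.
(** The vectors [e i] and the functionals [c i] form a finite coordinate system of V; this is how
    finite dimension enters the chain rule. *)
Variables (I : finType) (e : I -> V) (c : I -> {linear V -> R}).
Hypothesis cc : forall i, continuous (c i : V -> R).
Hypothesis ce : forall v, v = \sum_i c i v *: e i.

Lemma smooth_upto_comp n (O : set U) (O' : set V) (f : U -> V) (g : V -> W) :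
  open O -> open O' -> (forall x, O x -> O' (f x)) ->
  smooth_upto n O f -> smooth_upto n O' g -> smooth_upto n O (g \o f).
Proof.
move=> Oo Oo' fO; elim: n f fO g => [|n IHn] f fO g.
  move=> /smooth_upto0 df /smooth_upto0 dg; apply/smooth_upto0 => x Ox.
  by apply: differentiable_comp; [exact: df|exact/dg/fO].
move=> fs gs; have /smooth_uptoS[df dfs] := fs.
have /smooth_uptoS[dg dgs] := gs; apply/smooth_uptoS; split=> [x Ox|v].
  by apply: differentiable_comp; [exact: df|exact/dg/fO].
have fn := smooth_uptoW fs.
(* D_v (g o f) = sum_i c_i(D_v f) D_{e_i} g o f, so the order drops by one. *)
pose k i := c i \o (fun y => 'D_v f y).
have ks i : smooth_upto n O (k i) by exact: smooth_upto_linear_comp (dfs v).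
apply: smooth_upto_eq (smooth_upto_sum (f := fun i y => k i y *: 'D_(e i) g (f
  y))
  Oo _) => // [x Ox|i]; last first.
  by apply: smooth_upto_scale => //; exact: (IHn f fO _ fn (dgs (e i))).
have dfx := df x Ox; have dgx := dg _ (fO x Ox).
rewrite (deriveE v (differentiable_comp dfx dgx)) (diff_comp dfx dgx) /=.
rewrite -(deriveE v dfx) [in RHS](ce ('D_v f x)) linear_sum.
by apply: eq_bigr => i _; rewrite linearZ deriveE.
Qed.

Lemma smooth_on_comp (O : set U) (O' : set V) (f : U -> V) (g : V -> W) :
  open O -> open O' -> (forall x, O x -> O' (f x)) ->
  smooth_on O f -> smooth_on O' g -> smooth_on O (g \o f).
Proof.
move=> Oo Oo' fO /smooth_uptoP fs /smooth_uptoP gs; apply/smooth_uptoP => n.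
exact: smooth_upto_comp Oo Oo' fO (fs n) (gs n).
Qed.

End Composition.

(** * Derivatives relative to a subset, and their chain rule *)

Section RelativeDerivative.
Context {R : realType} {V W : normedModType R}.

(** The difference quotients on the two sides are the same functions of h, by linearity of B. *)
Lemma iter_derive_precomp (U : normedModType R) (B : {linear U -> V})
    (f : V -> W) s x :
  iter_derive s (f \o B) x = iter_derive (map B s) f (B x).
Proof.
elim: s x => [//|v s IHs] x /=; rewrite /derive.
set g1 := fun h : R => _; set g2 := fun h : R => _.
suff -> : g1 = g2 by [].
by apply/funext => h; rewrite /g1 /g2 /= !IHs linearP.
Qed.

(** The map a is affine with linear part B, so the admissible h and the difference quotients
    coincide on the two sides. *)
Lemma derive_in_precomp (U : normedModType R) (D : set U) (D' : set V)
    (a : U -> V) (B : {linear U -> V}) (f : V -> W) v x :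
  (forall y, D y <-> D' (a y)) -> (forall y w, a (y + w) = a y + B w) ->
  derive_in D v (f \o a) x = derive_in D' (B v) f (a x).
Proof.
move=> DD' aB; rewrite /derive_in.
have E h : a (x + h *: v) = a x + h *: B v by rewrite aB linearZ.
have -> : [set h | D (x + h *: v)] = [set h | D' (a x + h *: B v)].
  by apply/seteqP; split=> h /=; rewrite -E => /DD'.
set g1 := fun h : R => _; set g2 := fun h : R => _.
suff -> : g1 = g2 by [].
by apply/funext => h; rewrite /g1 /g2 /= E.
Qed.

Lemma iter_derive_in_precomp (U : normedModType R) (D : set U) (D' : set V)
    (B : {linear U -> V}) (f : V -> W) s x :
  (forall y, D y <-> D' (B y)) ->
  iter_derive_in D s (f \o B) x = iter_derive_in D' (map B s) f (B x).
Proof.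
move=> DD'; elim: s x => [//|v s IHs] x /=.
rewrite -(derive_in_precomp _ _ (D := D) (a := B)) //; last first.
  by move=> y w; rewrite linearD.
by congr derive_in; apply/funext => y; exact: IHs.
Qed.

(** The admissible h accumulate at 0, whatever the point of D and the direction; this makes the
    limit in [derive_in] unique. *)
Definition accessible (D : set V) := forall x v, D x ->
  ProperFilter (within [set h : R | D (x + h *: v)] (0 : R)^').

Variable D : set V.
Hypothesis Dacc : accessible D.

(** For small admissible h the difference quotients of f are those of F, whose full limit exists;
    accessibility makes it the value of the relative limit. *)
Lemma derive_in_eq (O : set V) (f F : V -> W) x v :
  open O -> O x -> D x -> (forall y, O y -> D y -> f y = F y) ->
  differentiable F x -> derive_in D v f x = 'D_v F x.
Proof.
move=> Oo Ox Dx fF dF; have FD := Dacc v Dx; apply: cvg_lim => //.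
have dFv : h^-1 *: (F (h *: v + x) - F x) @[h --> 0^'] --> 'D_v F x.
  exact: (diff_derivable (v := v) dF).
have dFw := cvg_within_filter [set h : R | D (x + h *: v)] dFv.
refine (cvg_trans _ (dFw _)).
apply: near_eq_cvg; rewrite near_withinE.
have : \forall h \near (0 : R)^', O (x + h *: v).
  apply: nbhs_dnbhs; have xc : (x + h *: v) @[h --> (0 : R)] --> x.
    rewrite -[X in _ --> X]addr0 -[X in _ --> _ + X](scale0r v).
    by apply: cvgD; [exact: cvg_cst|apply: cvgZr_tmp; exact: cvg_id].
  exact: (xc _ (open_nbhs_nbhs (conj Oo Ox))).
by apply: filterS => h Oh Dh; rewrite /= (addrC _ x) !fF.
Qed.

Lemma iter_derive_in_eq (O : set V) (f F : V -> W) s x :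
  open O -> smooth_on O F -> (forall y, O y -> D y -> f y = F y) ->
  O x -> D x -> iter_derive_in D s f x = iter_derive s F x.
Proof.
move=> Oo Fs fF; elim: s x => [|v s IHs] x Ox Dx /=; first exact: fF.
exact: (derive_in_eq _ Oo Ox Dx IHs (Fs s x Ox)).
Qed.

Lemma smooth_at_eq (O : set V) (f g : V -> W) x :
  open O -> O x -> (forall y, O y -> D y -> f y = g y) ->
  smooth_at D f x -> smooth_at D g x.
Proof.
move=> Oo Ox fg [ O' [F [ Oo' Ox' Fs fF]]]; exists (O `&` O'), F; split=> //.
- exact: openI.
- by apply: smooth_on_sub Fs => y [].
- by move=> y [ Oy Oy'] Dy; rewrite -fg // fF.
Qed.

(** One smooth extension of f near x also extends g, and it computes both derivatives. *)
Lemma iter_derive_in_eqr (O : set V) (f g : V -> W) x s :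
  open O -> O x -> D x -> (forall y, O y -> D y -> f y = g y) ->
  smooth_at D f x -> iter_derive_in D s f x = iter_derive_in D s g x.
Proof.
move=> Oo Ox Dx fg [ O' [F [ Oo' Ox' Fs fF]]].
have OOo : open (O `&` O') by exact: openI.
have Fs' : smooth_on (O `&` O') F by apply: smooth_on_sub Fs => y [].
rewrite (iter_derive_in_eq s OOo Fs') //; last by move=> y [_]; exact: fF.
by rewrite (iter_derive_in_eq s OOo Fs') // => y [ Oy Oy'] Dy;
  rewrite -fg // fF.
Qed.

Lemma smooth_at_add (f g : V -> W) x :
  smooth_at D f x -> smooth_at D g x -> smooth_at D (fun y => f y + g y) x.
Proof.
move=> [ O [F [ Oo Ox Fs fF]]] [ O' [G [ Oo' Ox' Gs gG]]].
have OOo : open (O `&` O') by exact: openI.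
exists (O `&` O'), (fun y => F y + G y); split=> //.
  by apply: smooth_on_add => //;
    [apply: smooth_on_sub Fs|apply: smooth_on_sub Gs] => y [].
by move=> y [ Oy Oy'] Dy; rewrite fF // gG.
Qed.

Lemma smooth_at_linear (A : {linear V -> W}) x : continuous A ->
  smooth_at D A x.
Proof.
move=> Ac; exists setT, A; split=> //; first exact: openT.
exact: smooth_on_linear.
Qed.

Lemma smooth_at_linear_comp (W' : normedModType R) (A : {linear W -> W'})
    (f : V -> W) x :
  continuous A -> smooth_at D f x -> smooth_at D (A \o f) x.
Proof.
move=> Ac [ O [F [ Oo Ox Fs fF]]]; exists O, (A \o F); split=> //.
  exact: smooth_on_linear_comp.
by move=> y Oy Dy; rewrite /= fF.
Qed.

End RelativeDerivative.

Lemma iter_derive_in_linear (R : realType) (V W W' : normedModType R)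
    (D : set V) (A : {linear W -> W'}) (f : V -> W) x s :
  accessible D -> continuous A -> D x -> smooth_at D f x ->
  iter_derive_in D s (A \o f) x = A (iter_derive_in D s f x).
Proof.
move=> Dacc Ac Dx [ O [F [ Oo Ox Fs fF]]].
have AFs : smooth_on O (A \o F) by exact: smooth_on_linear_comp.
rewrite (iter_derive_in_eq Dacc s Oo AFs) //; last by move=> y Oy Dy /=;
  rewrite fF.
by rewrite (iter_derive_in_eq Dacc s Oo Fs) // (iter_derive_linear Ac Oo).
Qed.

Section RelativeChainRule.
Context {R : realType} {U V W : normedModType R}.
Variables (I : finType) (e : I -> V) (c : I -> {linear V -> R}).
Hypothesis cc : forall i, continuous (c i : V -> R).
Hypothesis ce : forall v, v = \sum_i c i v *: e i.

(** Relative derivatives are ordinary derivatives of smooth extensions, so the ordinary chain rule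
    applies once the extensions can be composed. *)
Lemma smooth_at_comp_derive (D : set U) (D' : set V) (O : set U)
    (f : U -> V) (g : V -> W) x :
  accessible D -> accessible D' -> open O -> O x -> D x ->
  (forall y, O y -> D y -> D' (f y)) ->
  smooth_at D f x -> smooth_at D' g (f x) ->
  smooth_at D (g \o f) x /\ forall v,
    derive_in D v (g \o f) x = derive_in D' (derive_in D v f x) g (f x).
Proof.
move=> Da Da' Oo Ox Dx fD [ O1 [F [ Oo1 Ox1 Fs fF]]] [ O2 [G [ Oo2 Ox2 Gs gG]]].
(* On [O3] the extension F takes its values in the domain of G, so [G \o F] extends [g \o f]. *)
pose O3 := (O `&` O1) `&` F @^-1` O2.
have fx : f x = F x by exact: fF.
have O3x : O3 x by split => //=; rewrite -fx.
have Oo3 : open O3.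
  rewrite openE => y [[ Oy O1y] O2y].
  apply: filterI; first exact: open_nbhs_nbhs (conj (openI Oo Oo1) (conj Oy
    O1y)).
  have /differentiable_continuous Fc := smooth_on_diff Fs O1y.
  exact: (Fc _ (open_nbhs_nbhs (conj Oo2 O2y))).
have Fs3 : smooth_on O3 F by apply: smooth_on_sub Fs => y [[]].
have GFs : smooth_on O3 (G \o F).
  by apply: (smooth_on_comp cc ce Oo3 Oo2) Gs => // y [].
have gfE y : O3 y -> D y -> (g \o f) y = (G \o F) y.
  move=> [[ Oy O1y] O2y] Dy; have fy : f y = F y by exact: fF.
  rewrite /= fy gG // -fy; exact: fD.
split; first by exists O3, (G \o F).
move=> v; rewrite (derive_in_eq Da v Oo3 O3x Dx gfE (smooth_on_diff GFs O3x)).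
rewrite (derive_in_eq Da' _ Oo2 Ox2 (fD _ Ox Dx) gG (smooth_on_diff Gs Ox2)).
have dF := smooth_on_diff Fs Ox1.
rewrite (derive_in_eq Da v Oo1 Ox1 Dx fF dF).
rewrite fx in Ox2 *; have dG := smooth_on_diff Gs Ox2.
by rewrite (deriveE _ (differentiable_comp dF dG)) (diff_comp dF dG) /=
  !deriveE.
Qed.

End RelativeChainRule.

(** * The model space R^k x R^m and its half-space *)

Section Model.
Context {R : realType} {k m : nat}.
Notation model := ('rV[R]_k * 'rV[R]_m)%type.

(** If v points towards the outside of the half-space, then moving along -v stays inside; so h can
    tend to 0 from at least one side. *)
Lemma model_dom_accessible : accessible (@model_dom R m k).
Proof.
move=> x v Dx.
have [s s0 sD] : exists2 s : R, s != 0 &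
    forall h, 0 <= h -> @model_dom R m k (x + (h * s) *: v).
  have [[i i0 vi]|v0] := pselect (exists2 i : 'I_m, val i = 0%N & v.2 ord0 i <
    0).
    exists (-1); first by rewrite oppr_eq0 oner_eq0.
    move=> h h0 j j0; have -> : j = i by apply: val_inj; rewrite /= j0 i0.
    rewrite /= !mxE mulrN1 mulNr -mulrN addr_ge0 ?Dx // mulr_ge0 // oppr_ge0.
    exact: ltW.
  exists 1 => [|h h0 j j0]; first exact: oner_neq0.
  rewrite /= !mxE mulr1 addr_ge0 ?Dx // mulr_ge0 // leNgt; apply/negP => vj.
  by apply: v0; exists j.
apply: Build_ProperFilter_ex => P.
rewrite /within /= => -[e /= e0 eP].
(* A nonzero number with the sign of s and absolute value e / 2, hence inside the ball of radius
   e. *)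
pose t := e / 2 / `|s| * s.
have se : `|t| = e / 2.
  by rewrite /t normrM ger0_norm ?divr_ge0 ?(ltW e0) // divfK // normr_eq0.
exists t; apply: eP.
- by rewrite /= sub0r normrN se ltr_pdivrMr // ltr_pMr // ltr1n.
- by rewrite -normr_eq0 se gt_eqF // divr_gt0.
- by apply: sD; rewrite divr_ge0 // divr_ge0 // ltW.
Qed.

(** Together with [model_basis], the coordinate system that plays the roles of [c] and [e] in the
    chain rule. *)
Definition model_coord (i : 'I_k + 'I_m) (q : model) : R :=
  match i with inl a => q.1 ord0 a | inr b => q.2 ord0 b end.

Fact model_coord_linear i : linear (model_coord i).
Proof. by case: i => i a x y; rewrite /= !mxE. Qed.

HB.instance Definition _ i :=
  GRing.isLinear.Build R model R _ (model_coord i) (model_coord_linear i).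

Definition model_basis (i : 'I_k + 'I_m) : model :=
  match i with inl a => (delta_mx ord0 a, 0) | inr b => (0, delta_mx ord0 b)
    end.

Lemma model_coord_continuous i : continuous (model_coord i).
Proof.
case: i => i q; [have qc : fst @ q --> q.1 by exact: cvg_fst
                |have qc : snd @ q --> q.2 by exact: cvg_snd].
  exact: cvg_comp qc (@coord_continuous _ _ _ ord0 i q.1).
exact: cvg_comp qc (@coord_continuous _ _ _ ord0 i q.2).
Qed.

Lemma model_coordE (q : model) : q = \sum_i model_coord i q *: model_basis i.
Proof.
rewrite big_sumType /= [LHS]surjective_pairing [RHS]surjective_pairing.
congr pair; rewrite raddfD !raddf_sum /=.
  rewrite [X in _ = _ + X]big1 ?addr0 => [|b _]; last exact: scaler0.
  exact: row_sum_delta.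
rewrite [X in _ = X + _]big1 ?add0r => [|b _]; last exact: scaler0.
exact: row_sum_delta.
Qed.

End Model.

(** * Smooth maps, immersions and embeddings between products with M *)

Section SmoothMaps.
Context {R : realType} {m : nat} {M : manifold R m}.
Notation model k := ('rV[R]_k * 'rV[R]_m)%type.
Notation space k := ('rV[R]_k * M)%type.

Lemma local_point_dom k (phi : chart R m M) (p : space k) :
  atlas phi -> chart_dom phi p.2 -> @model_dom R m k (local_point phi p).
Proof.
move=> /atlas_chart[_ [ O _ E] _ _ _] dp.
have : (chart_fun phi @` chart_dom phi) (chart_fun phi p.2) by exists p.2.
by rewrite E => -[].
Qed.

Lemma local_repE k l (phi psi : chart R m M) (f : space k -> space l) p :
  atlas phi -> chart_dom phi p.2 ->
  local_rep phi psi f (local_point phi p) = local_point psi (f p).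
Proof.
move=> /atlas_chart[_ _ _ _ inv] dp; rewrite /local_rep /= inv //.
by rewrite -surjective_pairing.
Qed.

(** The chart has a relatively open image in the half-space and a continuous inverse there, so a
    property of points near p can be tested on model points near the image of p. *)
Lemma near_chart k (phi : chart R m M) (p : space k) (P : set (space k)) :
  atlas phi -> chart_dom phi p.2 -> nbhs p P ->
  exists O : set (model k), [/\ open O, O (local_point phi p) &
    forall q, O q -> @model_dom R m k q ->
      exists2 p', P p' /\ chart_dom phi p'.2 & q = local_point phi p'].
Proof.
move=> /atlas_chart[_ [ O1 Oo1 E] _ /subspace_continuousP ic inv] dp.
move=> [[A B] [ /= Ap Bp] ABP].
have imp : (chart_fun phi @` chart_dom phi) (chart_fun phi p.2) by exists p.2.
have iB : within (chart_fun phi @` chart_dom phi) (nbhs (chart_fun phi p.2))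
    (chart_inv phi @^-1` B) by apply: (ic _ imp); rewrite /from_subspace inv.
have O1p : nbhs (chart_fun phi p.2) O1.
  by apply: open_nbhs_nbhs; split=> //; move: imp; rewrite E => -[].
(* The last clause is an implication because [chart_inv] is controlled within the image of the
   chart. *)
pose N := [set q : model k | A q.1 /\ O1 q.2 /\
  ((chart_fun phi @` chart_dom phi) q.2 -> B (chart_inv phi q.2))].
have Np : nbhs (local_point phi p) N.
  exists (A, O1 `&` [set y | (chart_fun phi @` chart_dom phi) y ->
                             B (chart_inv phi y)]) => /=.
    by split=> //; apply: filterI.
  by move=> q [ /= Aq [qO qB]].
exists (N°); split; [exact: open_interior|by []|].
move=> [u y] /interior_subset [ /= Au [ O1y By]] Dy.
have [x dx xy] : (chart_fun phi @` chart_dom phi) y by rewrite E.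
exists (u, x); last by rewrite /local_point /= xy.
split=> //; apply: ABP; split=> //=.
have : B (chart_inv phi y) by apply: By; exists x.
by rewrite -xy inv.
Qed.

(** The representative of [g \o f] factors through the intermediate chart [chi] only near p, where f
    stays in the domain of [chi]; [near_chart] provides the open set on which the relative chain
    rule is applied. *)
Lemma smooth_map_comp_chart k l j (f : space k -> space l)
    (g : space l -> space j) (phi chi psi : chart R m M) p :
  continuous f -> atlas phi -> atlas chi ->
  chart_dom phi p.2 -> chart_dom chi (f p).2 ->
  smooth_at (@model_dom R m k) (local_rep phi chi f) (local_point phi p) ->
  smooth_at (@model_dom R m l) (local_rep chi psi g) (local_point chi (f p)) ->
  smooth_at (@model_dom R m k) (local_rep phi psi (g \o f)) (local_point phi p)
    /\
  forall v, derive_in (@model_dom R m k) v (local_rep phi psi (g \o f))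
      (local_point phi p) =
    derive_in (@model_dom R m l)
      (derive_in (@model_dom R m k) v (local_rep phi chi f) (local_point phi p))
      (local_rep chi psi g) (local_point chi (f p)).
Proof.
move=> fc aphi achi dp dfp fs gs.
have Pp : nbhs p [set p' | chart_dom chi (f p').2].
  have [od _ _ _ _] := atlas_chart achi.
  have f2c : snd (f x) @[x --> p] --> (f p).2.
    by apply: (@continuous_comp _ _ _ f snd p (fc p)); exact: cvg_snd.
  exact: (f2c _ (open_nbhs_nbhs (conj od dfp))).
have [ O [ Oo Op OP]] := near_chart aphi dp Pp.
have gfE q : O q -> @model_dom R m k q ->
    (local_rep chi psi g \o local_rep phi chi f) q = local_rep phi psi (g \o f)
      q.
  move=> Oq Dq; have [p' [ /= dfp' dp'] ->] := OP q Oq Dq.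
  by rewrite /= !local_repE.
have fD q : O q -> @model_dom R m k q ->
  @model_dom R m l (local_rep phi chi f q).
  move=> Oq Dq; have [p' [ /= dfp' dp'] ->] := OP q Oq Dq.
  by rewrite local_repE //; exact: local_point_dom.
have Dp := local_point_dom aphi dp.
have gs' : smooth_at (@model_dom R m l) (local_rep chi psi g)
    (local_rep phi chi f (local_point phi p)) by rewrite local_repE.
have [gfs gfd] := smooth_at_comp_derive (@model_coord_continuous R l m)
  (@model_coordE R l m) (@model_dom_accessible R k m) (@model_dom_accessible R
    l m) Oo Op Dp fD fs gs'.
split; first exact: smooth_at_eq Oo Op gfE gfs.
move=> v; rewrite -(local_repE chi f aphi dp); apply: etrans (gfd v).
exact/esym/(iter_derive_in_eqr (@model_dom_accessible R k m) [:: v] Oo Op Dp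
  gfE gfs).
Qed.

Lemma smooth_map_comp k l j (f : space k -> space l) (g : space l -> space j) :
  smooth_map f -> smooth_map g -> smooth_map (g \o f).
Proof.
move=> [fc fs] [gc gs]; split.
  by move=> p; exact: continuous_comp (fc p) (gc (f p)).
move=> phi psi p aphi apsi dp dgfp.
have [chi achi dfp] := atlas_cover (f p).2.
by have [] := smooth_map_comp_chart fc aphi achi dp dfp
  (fs _ _ _ aphi achi dp dfp) (gs _ _ _ achi apsi dfp dgfp).
Qed.

Lemma immersion_comp k l j (f : space k -> space l) (g : space l -> space j) :
  smooth_map f -> smooth_map g -> immersion f -> immersion g ->
  immersion (g \o f).
Proof.
move=> [fc fs] [gc gs] fi gi phi psi p v aphi apsi dp dgfp.
have [chi achi dfp] := atlas_cover (f p).2.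
have [_ ->] := smooth_map_comp_chart fc aphi achi dp dfp
  (fs _ _ _ aphi achi dp dfp) (gs _ _ _ achi apsi dfp dgfp).
by move=> /(gi _ _ _ _ achi apsi dfp dgfp); exact: fi.
Qed.

(** Differentiating [g \o f = id] in charts shows that v is the image under the derivative of g of
    the derivative of f along v; if the latter is 0, so is v. *)
Lemma immersion_cancel k l (f : space k -> space l) (g : space l -> space k) :
  smooth_map f -> smooth_map g -> cancel f g -> immersion f.
Proof.
move=> [fc fs] [gc gs] fK phi psi p v aphi apsi dp dfp fv0.
have dgfp : chart_dom phi (g (f p)).2 by rewrite fK.
have [_ /(_ v)] := smooth_map_comp_chart fc aphi apsi dp dfp
  (fs _ _ _ aphi apsi dp dfp) (gs _ _ _ apsi aphi dfp dgfp).
have Dp := local_point_dom aphi dp.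
have Dfp := local_point_dom apsi dfp.
have Da := @model_dom_accessible R k m.
rewrite fv0; have [ O [ Oo Op OP]] := near_chart aphi dp filterT.
rewrite (derive_in_eq (F := id) Da _ Oo Op Dp) //; last first.
  move=> q Oq Dq; have [p' [_ dp'] ->] := OP q Oq Dq.
  by rewrite local_repE //= fK.
rewrite derive_id => ->.
have [ O' [F [ Oo' Op' Fs fF]]] := gs _ _ _ apsi aphi dfp dgfp.
rewrite (derive_in_eq (@model_dom_accessible R l m) _ Oo' Op' Dfp fF).
  exact: derive0.
exact: smooth_on_diff Fs Op'.
Qed.

Lemma topological_embedding_comp (X Y Z : topologicalType) (f : X -> Y)
    (g : Y -> Z) :
  topological_embedding f -> topological_embedding g ->
  topological_embedding (g \o f).
Proof.
move=> [fi fc fo] [gi gc go]; split.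
- exact: inj_comp.
- by move=> x; exact: continuous_comp (fc x) (gc (f x)).
- move=> O /fo[ O' /go[ O'' oO'' gE] fE]; exists O'' => //.
  apply/seteqP; split=> z.
    move=> [x Ox <-] /=; split; last by exists x.
    have : (f @` O) (f x) by exists x.
    rewrite fE => -[ O'fx _].
    have : (g @` O') (g (f x)) by exists (f x).
    by rewrite gE => -[].
  move=> [ O''z [x _ zE]]; exists x => //.
  have : (g @` O') z by rewrite gE; split=> //; exists (f x).
  move=> [y O'y yz]; have yfx : y = f x by apply: gi; rewrite yz -zE.
  have : (f @` O) (f x) by rewrite fE -yfx; split=> //; exists x.
  by move=> [x' Ox' /fi <-].
Qed.

Lemma topological_embedding_cancel (X Y : topologicalType) (f : X -> Y)
    (g : Y -> X) :
  continuous f -> continuous g -> cancel f g -> topological_embedding f.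
Proof.
move=> fc gc fK; split=> //; first exact: can_inj fK.
move=> O oO; exists (g @^-1` O); first by apply: open_comp => // y _.
apply/seteqP; split=> y; first by move=> [x Ox <-]; split;
  [rewrite /= fK|exists x].
by move=> [ /= Ogy [x _ xy]]; exists x => //; rewrite -xy fK in Ogy.
Qed.

Lemma smooth_embedding_comp k l j (f : space k -> space l)
    (g : space l -> space j) :
  smooth_embedding f -> smooth_embedding g -> smooth_embedding (g \o f).
Proof.
move=> [fs fi ft] [gs gi gt]; split.
- exact: smooth_map_comp.
- exact: immersion_comp.
- exact: topological_embedding_comp.
Qed.

Lemma smooth_embedding_cancel k l (f : space k -> space l)
    (g : space l -> space k) :
  smooth_map f -> smooth_map g -> cancel f g -> smooth_embedding f.
Proof.
move=> fs gs fK; split=> //; first exact: immersion_cancel fK.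
by apply: topological_embedding_cancel fK; [case: fs|case: gs].
Qed.

End SmoothMaps.

(** * Continuity of linear maps in coordinates, and precomposition with them *)

Section LinearContinuity.
Context {R : realType} {V W : normedModType R}.

Lemma linear_continuous_basis (I : finType) (e : I -> V)
    (c : I -> {linear V -> R}) (A : {linear V -> W}) :
  (forall i, continuous (c i : V -> R)) ->
  (forall v, v = \sum_i c i v *: e i) -> continuous A.
Proof.
move=> cc ce.
have -> : (A : V -> W) = fun v => \sum_i c i v *: A (e i).
  apply/funext => v; rewrite [in LHS](ce v) linear_sum.
  by apply: eq_bigr => i _; rewrite linearZ.
apply: continuous_big => [|i _ v]; first exact: add_continuous.
by apply: continuousZr_tmp; exact: cc.
Qed.

Fact pair_right_linear : linear (fun x : W => (0 : V, x)).
Proof. by move=> a x y; congr pair; rewrite /= scaler0 addr0. Qed.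

End LinearContinuity.

Section RowContinuity.
Context {R : realType}.

Fact coord_linear n (i : 'I_n) : linear (fun t : 'rV[R]_n => t ord0 i).
Proof. by move=> a x y; rewrite !mxE. Qed.

Lemma row_linear_continuous n (W : normedModType R) (A : {linear 'rV[R]_n ->
  W}) :
  continuous A.
Proof.
pose c i : {linear 'rV[R]_n -> R} :=
  HB.pack (fun t : 'rV[R]_n => t ord0 i)
    (GRing.isLinear.Build _ _ _ _ _ (coord_linear i)).
apply: (linear_continuous_basis (c := c) (e := fun i => delta_mx ord0 i)).
  by move=> i; exact: coord_continuous.
by move=> v; exact: row_sum_delta.
Qed.

Lemma model_linear_continuous k m (W : normedModType R)
    (A : {linear ('rV[R]_k * 'rV[R]_m)%type -> W}) : continuous A.
Proof.
exact: linear_continuous_basis (@model_coord_continuous R k m)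
  (@model_coordE R k m).
Qed.

Lemma row_continuous (X : topologicalType) n (f : X -> 'rV[R]_n) :
  (forall i, continuous (fun x => f x ord0 i)) -> continuous f.
Proof.
move=> fc x A [P Px PA].
have : \forall y \near x, forall i, P ord0 i (f y ord0 i).
  by apply: filter_forall => i; exact: (fc i x _ (Px _ _)).
apply: filterS => y Py; apply: PA => i j; rewrite ord1; exact: Py.
Qed.

End RowContinuity.

Section Precomposition.
Context {R : realType} {U V W : normedModType R}.

Lemma smooth_at_precomp (D : set U) (D' : set V) (B : {linear U -> V})
    (f : V -> W) x :
  continuous B -> (forall y, D y -> D' (B y)) ->
  smooth_at D' f (B x) -> smooth_at D (f \o B) x.
Proof.
move=> Bc DD [ O [F [ Oo Ox Fs fF]]]; exists (B @^-1` O), (F \o B); split=> //.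
- by apply: open_comp => // y _; exact: Bc.
- move=> s y Oy; rewrite -/(iter_derive _ _).
  rewrite (_ : iter_derive s (F \o B) = iter_derive (map B s) F \o B);
    last first.
    by apply/funext => z; exact: iter_derive_precomp.
  exact: differentiable_comp (linear_differentiable _ Bc) (Fs _ _ Oy).
- by move=> y Oy /DD Dy; exact: fF.
Qed.

Lemma smooth_at_cst (D : set V) (a : W) x : smooth_at D (cst a) x.
Proof.
exists setT, (cst a); split=> //; first exact: openT.
by apply/smooth_uptoP => n; exact: smooth_upto_cst.
Qed.

End Precomposition.

(** * Dropping and inserting a coordinate *)

Section Coordinates.
Context {R : realType}.

(** The type T is left free: with T = M this acts on points, with T = R^m on their local
    representatives. *)
Definition drop_coord n T (c : 'I_n.+1) (p : 'rV[R]_n.+1 * T) : 'rV[R]_n * T :=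
  (col' c p.1, p.2).

Definition add_coord n T (c : 'I_n.+1) (x : R) (p : 'rV[R]_n * T) :
    'rV[R]_n.+1 * T := (insert_coord c x p.1, p.2).

Lemma insert_coord_same n (c : 'I_n.+1) x (t : 'rV[R]_n) :
  insert_coord c x t ord0 c = x.
Proof. by rewrite mxE unlift_none. Qed.

Lemma insert_coord_lift n (c : 'I_n.+1) x (t : 'rV[R]_n) i :
  insert_coord c x t ord0 (lift c i) = t ord0 i.
Proof. by rewrite mxE liftK. Qed.

Lemma insert_coordK n (c : 'I_n.+1) x : cancel (insert_coord c x) (@col' R 1 _
  c).
Proof. by move=> t; apply/rowP => i; rewrite mxE insert_coord_lift. Qed.

Lemma col'K n (c : 'I_n.+1) (t : 'rV[R]_n.+1) :
  insert_coord c (t ord0 c) (col' c t) = t.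
Proof.
by apply/rowP => i; rewrite mxE; case: unliftP => [j|] ->; rewrite ?mxE.
Qed.

Lemma add_coordK n T (c : 'I_n.+1) x :
  cancel (@add_coord n T c x) (@drop_coord n T c).
Proof. by move=> [t v]; rewrite /drop_coord /= insert_coordK. Qed.

Lemma drop_coordK n T (c : 'I_n.+1) (p : 'rV[R]_n.+1 * T) :
  add_coord c (p.1 ord0 c) (drop_coord c p) = p.
Proof. by rewrite /add_coord /= col'K -surjective_pairing. Qed.

Lemma add_coord_fst n T (c : 'I_n.+1) x (p : 'rV[R]_n * T) :
  (add_coord c x p).1 ord0 c = x.
Proof. exact: insert_coord_same. Qed.

Fact drop_coord_linear n m (c : 'I_n.+1) : linear (@drop_coord n 'rV[R]_m c).
Proof. by move=> a x y; congr pair; apply/rowP => i; rewrite !mxE. Qed.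

HB.instance Definition _ n m c := GRing.isLinear.Build R
  ('rV[R]_n.+1 * 'rV[R]_m)%type ('rV[R]_n * 'rV[R]_m)%type _
  (@drop_coord n 'rV[R]_m c) (drop_coord_linear c).

Fact add_coord_linear n m (c : 'I_n.+1) : linear (@add_coord n 'rV[R]_m c 0).
Proof.
move=> a x y; congr pair; apply/rowP => i; rewrite !mxE.
by case: unliftP => [j|] _; rewrite ?mxE // mulr0 addr0.
Qed.

HB.instance Definition _ n m c := GRing.isLinear.Build R
  ('rV[R]_n * 'rV[R]_m)%type ('rV[R]_n.+1 * 'rV[R]_m)%type _
  (@add_coord n 'rV[R]_m c 0) (add_coord_linear c).

(** The projection onto the c-th axis: the summand of the local representative of a graph that does
    not depend on the graphed map. *)
Definition axis n m (c : 'I_n.+1) (q : 'rV[R]_n.+1 * 'rV[R]_m) :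
    'rV[R]_n.+1 * 'rV[R]_m := add_coord c (q.1 ord0 c) 0.

Fact axis_linear n m (c : 'I_n.+1) : linear (@axis n m c).
Proof.
move=> a x y; congr pair; last by rewrite /= scaler0 addr0.
apply/rowP => i; rewrite !mxE.
by case: unliftP => [j|] _; rewrite ?mxE // mulr0 addr0.
Qed.

HB.instance Definition _ n m c := GRing.isLinear.Build R
  ('rV[R]_n.+1 * 'rV[R]_m)%type ('rV[R]_n.+1 * 'rV[R]_m)%type _
  (@axis n m c) (axis_linear c).

(** Inserting the constant x is an affine map with linear part [add_coord c 0]. *)
Lemma add_coordE n m (c : 'I_n.+1) x (q : 'rV[R]_n * 'rV[R]_m) :
  add_coord c x q = add_coord c 0 q + add_coord c x 0.
Proof.
congr pair; last by rewrite /= addr0.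
apply/rowP => i; rewrite !mxE; case: unliftP => [j|] _; rewrite ?mxE //.
  by rewrite addr0.
by rewrite add0r.
Qed.

Lemma add_coordD n m (c : 'I_n.+1) x (q w : 'rV[R]_n * 'rV[R]_m) :
  add_coord c x (q + w) = add_coord c x q + add_coord c 0 w.
Proof.
congr pair; apply/rowP => i; rewrite !mxE; case: unliftP => [j|] _.
  by rewrite !mxE.
by rewrite addr0.
Qed.

End Coordinates.

Lemma continuous_pair (X Y Z : topologicalType) (f : X -> Y) (g : X -> Z) :
  continuous f -> continuous g -> continuous (fun x => (f x, g x)).
Proof. by move=> fc gc x; exact: cvg_pair (fc x) (gc x). Qed.

(** * Smoothness and immersivity of graphs *)

Section GraphMaps.
Context {R : realType} {m : nat} {M : manifold R m}.
Notation model k := ('rV[R]_k * 'rV[R]_m)%type.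
Notation space k := ('rV[R]_k * M)%type.

(** In charts the map is a linear map, plus a constant, plus a change of charts of M placed in the
    second factor; the last is smooth by compatibility of the atlas. *)
Lemma smooth_map_affine k l (a : 'rV[R]_k -> 'rV[R]_l)
    (A : {linear 'rV[R]_k -> 'rV[R]_l}) b :
  (forall t, a t = A t + b) -> smooth_map (fun p : space k => (a p.1, p.2)).
Proof.
move=> aE; split.
  apply: continuous_pair => p; last exact: cvg_snd.
  apply: (@continuous_comp _ _ _ fst a p); first exact: cvg_fst.
  rewrite (_ : a = fun t => A t + b); last by apply/funext.
  have Ac : A t @[t --> p.1] --> A p.1 by exact: row_linear_continuous.
  exact: cvgD Ac (cvg_cst b).
move=> phi psi p aphi apsi /= dp dpsi.
have Ll : linear (fun q : model k => (A q.1, 0) : model l).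
  by move=> x q q'; congr pair; rewrite /= ?linearP // scaler0 addr0.
pose L : {linear model k -> model l} :=
  HB.pack (fun q : model k => (A q.1, 0) : model l)
    (GRing.isLinear.Build _ _ _ _ _ Ll).
pose J : {linear 'rV[R]_m -> model l} :=
  HB.pack (fun x : 'rV[R]_m => (0, x) : model l)
    (GRing.isLinear.Build _ _ _ _ _ (@pair_right_linear R 'rV[R]_l 'rV[R]_m)).
pose T : model k -> 'rV[R]_m := (chart_fun psi \o chart_inv phi) \o snd.
have -> : local_rep phi psi (fun p : space k => (a p.1, p.2)) =
    fun q => L q + ((b, 0) + J (T q)).
  apply/funext => q; rewrite /local_rep /local_point /= aE.
  by congr pair; rewrite /= ?addr0 ?add0r.
apply: smooth_at_add.
  by apply: smooth_at_linear; exact: model_linear_continuous.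
apply: smooth_at_add.
  exact: smooth_at_cst.
apply: (smooth_at_linear_comp (A := J)); first exact: row_linear_continuous.
apply: (smooth_at_precomp (D' := @half_space R m)) => //.
  by move=> q; exact: cvg_snd.
exact: atlas_smooth.
Qed.

Lemma smooth_map_drop_coord n (c : 'I_n.+1) : smooth_map (@drop_coord R n M c).
Proof.
have cl : linear (@col' R 1 n.+1 c).
  by move=> x t t'; apply/rowP => i; rewrite !mxE.
pose A : {linear 'rV[R]_n.+1 -> 'rV[R]_n} :=
  HB.pack (@col' R 1 n.+1 c) (GRing.isLinear.Build _ _ _ _ _ cl).
by apply: (smooth_map_affine (A := A) (b := 0)) => t; rewrite addr0.
Qed.

Lemma smooth_map_add_coord n (c : 'I_n.+1) x :
  smooth_map (@add_coord R n M c x).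
Proof.
have il : linear (@insert_coord R n c 0).
  move=> y t t'; apply/rowP => i; rewrite !mxE.
  by case: unliftP => [j|] _; rewrite ?mxE // mulr0 addr0.
pose A : {linear 'rV[R]_n -> 'rV[R]_n.+1} :=
  HB.pack (@insert_coord R n c 0) (GRing.isLinear.Build _ _ _ _ _ il).
apply: (smooth_map_affine (A := A) (b := insert_coord c x 0)) => t.
apply/rowP => i; rewrite !mxE; case: unliftP => [j|] _; rewrite ?mxE //.
  by rewrite addr0.
by rewrite add0r.
Qed.

(** For c = 0 and G the adjoint of a loop this is [graphing]; for G independent of the c-th
    coordinate it is the product to which elements of [PEC] are compared. *)
Definition graph_map n (c : 'I_n.+1) (G : space n.+1 -> space n)
  (p : space n.+1) : space n.+1 := add_coord c (p.1 ord0 c) (G p).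

(** In charts a graph is the linear map [add_coord c 0] applied to the representative of G, plus the
    linear map [axis c]. *)
Lemma smooth_map_graph n (c : 'I_n.+1) (G : space n.+1 -> space n) :
  smooth_map G -> smooth_map (graph_map c G).
Proof.
move=> [Gc Gs]; split.
  apply: continuous_pair => p; last first.
    by apply: (@continuous_comp _ _ _ G snd p (Gc p)); exact: cvg_snd.
  have cc (i : 'I_n.+1) : continuous (fun p : space n.+1 => p.1 ord0 i).
    move=> q.
    apply: (@continuous_comp _ _ _ fst (fun t : 'rV[R]_n.+1 => t ord0 i) q).
      exact: cvg_fst.
    exact: coord_continuous.
  have := @row_continuous R (space n.+1) n.+1
    (fun p => insert_coord c (p.1 ord0 c) (G p).1) _ p.
  apply=> i; case: (unliftP c i) => [j|] ->.
    rewrite (_ : (fun x => _) = fun q => (G q).1 ord0 j); last first.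
      by apply/funext => q; rewrite insert_coord_lift.
    move=> q.
    apply: (@continuous_comp _ _ _ (fst \o G) (fun t : 'rV[R]_n => t ord0 j) q).
      by apply: (@continuous_comp _ _ _ G fst q (Gc q)); exact: cvg_fst.
    exact: coord_continuous.
  rewrite (_ : (fun x => _) = fun q : space n.+1 => q.1 ord0 c);
    first exact: cc.
  by apply/funext => q; rewrite insert_coord_same.
move=> phi psi p aphi apsi dp dGp.
have -> : local_rep phi psi (graph_map c G) =
    fun q => add_coord c 0 (local_rep phi psi G q) + axis c q.
  apply/funext => q.
  rewrite -[RHS]/(add_coord c 0 _ + add_coord c (q.1 ord0 c) 0).
  by rewrite -add_coordE.
apply: smooth_at_add.
  apply: smooth_at_linear_comp; first exact: model_linear_continuous.
  exact: Gs.
by apply: smooth_at_linear; exact: model_linear_continuous.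
Qed.

Lemma immersion_graph n (c : 'I_n.+1) (G : space n.+1 -> space n) :
  smooth_map G -> (forall x, immersion (G \o add_coord c x)) ->
  immersion (graph_map c G).
Proof.
move=> Gs Gi phi psi p v aphi apsi dp dGp gv0.
(* A vector killed by the derivative of the graph has no c-component, so it is
   tangent to a slice, where the derivative is that of the immersion G. *)
have [_ /(_ _ _ p aphi apsi dp dGp) gs] := smooth_map_graph c Gs.
have Dp := local_point_dom aphi dp.
have Da := @model_dom_accessible R n.+1 m.
have Gv0 : derive_in (@model_dom R m n.+1) v (local_rep phi psi G)
    (local_point phi p) = 0.
  have rE : @drop_coord R n 'rV[R]_m c \o local_rep phi psi (graph_map c G) =
      local_rep phi psi G.
    apply/funext => q; exact: (add_coordK c (q.1 ord0 c)
      (local_rep phi psi G q)).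
  have dc := @model_linear_continuous R _ _ _ (@drop_coord R n 'rV[R]_m c).
  rewrite -rE; apply: etrans (iter_derive_in_linear [:: v] Da dc Dp gs) _.
  by rewrite [iter_derive_in _ _ _ _]gv0 linear0.
(* The c-component of the representative of a graph is the c-th coordinate function, whose
   derivative along v is the c-th entry of v. *)
have vc : v.1 ord0 c = 0.
  have rE : @model_coord R n.+1 m (inl c) \o local_rep phi psi (graph_map c G) =
      model_coord (inl c).
    by apply/funext => q /=; exact: insert_coord_same.
  have mc := @model_coord_continuous R n.+1 m (inl c).
  have := iter_derive_in_linear [:: v] Da mc Dp gs.
  rewrite [iter_derive_in _ _ (local_rep _ _ _) _]gv0 linear0 => <-.
  rewrite rE /= (derive_in_eq (F := model_coord (inl c)) Da _ openT) //.
    by rewrite derive_linear.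
  exact: linear_differentiable.
have vE : @add_coord R n 'rV[R]_m c 0 (drop_coord c v) = v.
  by rewrite -[X in add_coord c X]vc drop_coordK.
have ptE : @add_coord R n 'rV[R]_m c (p.1 ord0 c)
    (local_point phi (drop_coord c p)) = local_point phi p.
  by congr pair; exact: col'K.
have dG' : chart_dom psi ((G \o add_coord c (p.1 ord0 c)) (drop_coord c p)).2.
  by rewrite /comp drop_coordK.
have E := @derive_in_precomp R (model n.+1) _ (model n) (@model_dom R m n)
  (@model_dom R m n.+1) (add_coord c (p.1 ord0 c))
  (@add_coord R n 'rV[R]_m c 0) (local_rep phi psi G) (drop_coord c v)
  (local_point phi (drop_coord c p))
  (fun y => conj (fun yD => yD) (fun yD => yD)) (add_coordD c _).
have gi := Gi _ phi psi (drop_coord c p) (drop_coord c v) aphi apsi dp dG'.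
have dv0 : drop_coord c v = 0.
  by apply: gi; apply: etrans E _; rewrite [X in derive_in _ X]vE ptE.
rewrite -vE dv0.
exact: (raddf0 (@add_coord R n 'rV[R]_m c 0)).
Qed.

End GraphMaps.

(** * Norms on the model space, coordinate by coordinate *)

Section ModelNorm.
Context {R : realType}.

Lemma row_norm_lt n (t : 'rV[R]_n) e : 0 < e ->
  `|t| < e <-> forall i, `|t ord0 i| < e.
Proof.
move=> e0; rewrite [`|t|]/Num.norm /= mx_normrE; split.
  by move=> /bigmax_ltP[_ te] i; exact: (te (ord0, i)).
by move=> te; apply/bigmax_ltP; split=> // -[i j] _; rewrite ord1; exact: te.
Qed.

(** All the norms are maxima over coordinates, so the c-th coordinate splits off with the same bound
    e. *)
Lemma model_norm_lt n m (c : 'I_n.+1) (w : 'rV[R]_n.+1 * 'rV[R]_m) e : 0 < e ->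
  `|w| < e <-> `|w.1 ord0 c| < e /\ `|drop_coord c w| < e.
Proof.
move=> e0; rewrite !prod_normE /= !gt_max; split.
  move=> /andP[/(row_norm_lt _ e0) w1 w2]; split; first exact: w1.
  rewrite w2 andbT; apply/(row_norm_lt _ e0) => i; rewrite mxE; exact: w1.
move=> [wc /andP[/(row_norm_lt _ e0) w1 w2]]; rewrite w2 andbT.
apply/(row_norm_lt _ e0) => i; case: (unliftP c i) => [j|] -> //.
by have := w1 j; rewrite mxE.
Qed.

End ModelNorm.

(** * Supports of self-maps *)

Section Supports.

Lemma hausdorff_pair (X Y : topologicalType) :
  hausdorff_space X -> hausdorff_space Y -> hausdorff_space (X * Y)%type.
Proof.
move=> hX hY [x y] [x' y'] cl; congr pair.
  apply: hX => A B Ax Bx'.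
  have [||[a b] [ /= [aA _] [aB _]]] := cl (A `*` setT) (B `*` setT).
  - by exists (A, setT) => //; split=> //; exact: filterT.
  - by exists (B, setT) => //; split=> //; exact: filterT.
  - by exists a.
apply: hY => A B Ay By'.
have [||[a b] [ /= [_ bA] [_ bB]]] := cl (setT `*` A) (setT `*` B).
- by exists (setT, A) => //; split=> //; exact: filterT.
- by exists (setT, B) => //; split=> //; exact: filterT.
- by exists b.
Qed.

(** The support without its closure, as in the definition of EC; that it can be open is what makes
    it useful. *)
Definition moved (X : Type) (f : X -> X) : set X := [set x | f x <> x].

(** If fixed points accumulated at x, no neighbourhoods of x and f x would be disjoint. *)
Lemma moved_open (X : topologicalType) (f : X -> X) :
  hausdorff_space X -> continuous f -> open (moved f).
Proof.
move=> hX fc; rewrite openE => x fx.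
apply: contrapT => Nx; apply: fx; apply: hX => A B Afx Bx.
have near_AB : nbhs x (f @^-1` A `&` B) by apply: filterI => //; exact: fc.
apply: contrapT => AB0; apply: Nx; apply: filterS near_AB => y [Ay By] fy.
by apply: AB0; exists y; split=> //; rewrite -[y]fy.
Qed.

(** An injective map sends its support into itself, so a point moved by f goes to a point that g
    fixes, and conversely. *)
Lemma comp_disjoint_support (X : Type) (f g : X -> X) :
  injective f -> injective g -> (forall x, moved f x -> ~ moved g x) ->
  f \o g = g \o f.
Proof.
move=> fi gi fg; apply/funext => x /=.
have [fx|fx] := pselect (f x = x).
  have [gx|gx] := pselect (g x = x); first by rewrite gx fx gx.
  rewrite fx; apply: contrapT => fgx; apply: (fg _ fgx) => ggx.
  exact/gx/gi.
have gx : g x = x by apply: contrapT => gx; exact: fg fx gx.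
rewrite gx; apply/esym; apply: contrapT => gfx.
by apply: (fg (f x)) gfx => ffx; exact/fx/fi.
Qed.

(* A closed set C has image f(C `&` K) `|` (C `&` {f = id}), which is closed. *)
Lemma compact_support_embedding (X : topologicalType) (f : X -> X) (K : set X) :
  hausdorff_space X -> continuous f -> injective f -> compact K ->
  moved f `<=` K -> topological_embedding f.
Proof.
move=> hX fc fi Kc fK; split=> // O oO.
(* By injectivity the image of O is the part of the range outside the image of its complement, so it
   suffices that f is a closed map. *)
exists (~` (f @` (~` O))); last first.
  apply/seteqP; split=> y.
    by move=> [x Ox <-]; split; [move=> [x' Ox' /fi xx'];
      rewrite -xx' in Ox|exists x].
  move=> [yO [x _ xy]]; exists x => //; apply: contrapT => Ox.
  by apply: yO; exists x.
rewrite openC.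
have cO : closed (~` O) by exact: open_closedC.
have -> : f @` (~` O) = f @` (~` O `&` K) `|` (~` O `&` ~` moved f).
  apply/seteqP; split=> y.
    move=> [x Ox <-]; have [fx|fx] := pselect (moved f x).
      by left; exists x => //; split=> //; exact: fK.
    by move/contrapT: (fx) => ->; right.
  by move=> [[x [Ox _] <-]|[Oy /contrapT fy]]; [exists x|exists y].
apply: closedU.
  apply: compact_closed => //; apply: continuous_compact.
    exact: continuous_subspaceT.
  by rewrite setIC; exact: compact_closedI.
by apply: closedI => //; apply: open_closedC; exact: moved_open.
Qed.

End Supports.

(** * Compositions in the order of a key *)

Section OrderedComposition.
Context {R : realType} {T : Type} {j : nat}.
Variables (key : 'I_j -> R) (f : 'I_j -> T -> T).

Definition seq_comp (l : seq 'I_j) : T -> T := foldr (fun i h => f i \o h) id l.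

Lemma ordered_compE (s : {perm 'I_j}) :
  ordered_comp s f = seq_comp [seq s i | i <- index_enum 'I_j].
Proof.
rewrite /ordered_comp; elim: (index_enum _) => [|i r IHr] /=.
  by rewrite big_nil.
by rewrite big_cons IHr.
Qed.

Lemma ordered_comp_closed (P : (T -> T) -> Prop) (s : {perm 'I_j}) :
  P id -> (forall g h, P g -> P h -> P (g \o h)) -> (forall i, P (f i)) ->
  P (ordered_comp s f).
Proof.
move=> P1 PM Pf; rewrite ordered_compE.
by elim: [seq _ | _ <- _] => //= i r IHr; exact: PM.
Qed.

Lemma index_enum_ordered : pairwise leq (map val (index_enum 'I_j)).
Proof.
rewrite -sorted_pairwise; last exact: leq_trans.
by rewrite /index_enum -enumT val_enum_ord; exact: iota_sorted.
Qed.

Lemma ordering_exists : exists s : {perm 'I_j}, ordering key s.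
Proof.
pose leK := [rel a b : 'I_j | key a <= key b].
have leKt : total leK by move=> a b; exact: le_total.
have leKtr : transitive leK by move=> a b c; exact: le_trans.
pose t := sort leK (enum 'I_j).
have st : size t = j by rewrite size_sort size_enum_ord.
have tu : uniq t by rewrite sort_uniq enum_uniq.
(* The list of all indices sorted by key, read as a map; the default i is out of reach because the
   list has length j, and g is injective because the list has no repetitions. *)
pose g (i : 'I_j) := nth i t i.
have gi : injective g.
  move=> a b; rewrite /g (set_nth_default b) ?st // => /eqP.
  by rewrite nth_uniq ?st // => /eqP/ord_inj.
exists (perm gi) => a b ab; rewrite !permE /g (set_nth_default b) ?st //.
have := sorted_leq_nth leKtr (fun x => le_refl (key x)) b (sort_sorted leKt _).
by apply; rewrite ?inE ?st //.
Qed.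

Hypothesis fcomm : forall a b, key a = key b -> f a \o f b = f b \o f a.

Lemma seq_comp_commute a (l l' : seq 'I_j) :
  (forall b, b \in l -> key b = key a) ->
  seq_comp (l ++ a :: l') = f a \o seq_comp (l ++ l').
Proof.
elim: l => [//|b l IHl] la /=; rewrite IHl; last first.
  by move=> b' b'l; apply: la; rewrite inE b'l orbT.
have /(_ (mem_head _ _)) ba := la b.
exact: (congr1 (fun h => h \o seq_comp (l ++ l')) (fcomm ba)).
Qed.

(** Two sorted arrangements of the same indices differ by exchanges among indices of equal key,
    whose factors commute. *)
Lemma seq_comp_perm (l l' : seq 'I_j) :
  pairwise (fun a b => key a <= key b) l ->
  pairwise (fun a b => key a <= key b) l' ->
  perm_eq l l' -> seq_comp l = seq_comp l'.
Proof.
elim: l l' => [|a l IHl] l'; first by rewrite perm_sym => _ _ /perm_nilP ->.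
rewrite pairwise_cons => /andP[al ls] l's ll'.
have al' : a \in l' by rewrite -(perm_mem ll') mem_head.
case/splitPr: al' l's ll' => l1 l2 l's ll'.
(* An entry before a in l' has key at most that of a, and, lying in the sorted list a :: l, at least
   that of a. *)
have l1a b : b \in l1 -> key b = key a.
  move=> bl1; apply: le_anti; move: l's; rewrite pairwise_cat => /and3P[h _ _].
  rewrite (allrelP h) ?mem_head //=.
  have : b \in a :: l by rewrite (perm_mem ll') mem_cat bl1.
  by rewrite inE => /predU1P[->//|bl]; exact: (allP al).
(* The entries before a in l' have the key of a, hence commute with f a. *)
rewrite /= (seq_comp_commute _ l1a); congr (f a \o _); apply: IHl => //.
  move: l's; rewrite !pairwise_cat /= => /and3P[h -> /andP[_ ->]].
  rewrite !andbT; apply/allrelP => x y xl yl; apply: (allrelP h) => //.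
  by rewrite inE yl orbT.
by move: ll'; rewrite perm_sym -cat1s perm_catCA /= perm_cons perm_sym.
Qed.

Lemma ordered_comp_unique (s s' : {perm 'I_j}) :
  ordering key s -> ordering key s' -> ordered_comp s f = ordered_comp s' f.
Proof.
have ordered r : ordering key r ->
    pairwise (fun a b => key a <= key b) [seq r i | i <- index_enum 'I_j].
  move=> ro; rewrite pairwise_map.
  have := index_enum_ordered; rewrite pairwise_map; apply: sub_pairwise.
  by move=> a b; exact: ro.
move=> so s'o; rewrite !ordered_compE; apply: seq_comp_perm; try exact: ordered.
apply: uniq_perm; try by rewrite map_inj_uniq ?index_enum_uniq //;
  exact: perm_inj.
have full (r : {perm 'I_j}) i : i \in [seq r x | x <- index_enum 'I_j].
  by apply/mapP; exists (r^-1 i)%g; rewrite ?mem_index_enum ?permKV.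
by move=> i; rewrite !full.
Qed.

(** The set on the left has the shape of the cube actions: this is the existence of an admissible
    permutation together with independence of its choice. *)
Lemma ordered_comp_set1 : exists2 s : {perm 'I_j}, ordering key s &
  [set g | exists2 s : {perm 'I_j}, ordering key s & g = ordered_comp s f] =
  [set ordered_comp s f].
Proof.
have [s so] := ordering_exists; exists s => //.
apply/seteqP; split=> g; first by move=> [s' s'o ->];
  exact: ordered_comp_unique.
by move=> ->; exists s.
Qed.

End OrderedComposition.

(** * Geometry of little cubes *)

Section Cubes.
Context {R : realType}.

Lemma slope_gt0 k (L : @little_cube R k) i : 0 < slope L i.
Proof. by case/andP: (slope_bounds L i). Qed.

Lemma slope_neq0 k (L : @little_cube R k) i : slope L i != 0.
Proof. exact/lt0r_neq0/slope_gt0. Qed.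

Lemma initial_ge k (L : @little_cube R k) i : -1 <= initial i L.
Proof.
by have /andP[] : -1 <= slope L i * -1 + offset L i <= 1
  by apply: little_cube_sub; rewrite lexx (le_trans (lerN10 R) ler01).
Qed.

Lemma slope_offset_le k (L : @little_cube R k) i : slope L i + offset L i <= 1.
Proof.
have /andP[_] : -1 <= slope L i * 1 + offset L i <= 1.
  by apply: little_cube_sub; rewrite lexx (le_trans (lerN10 R) ler01).
by rewrite mulr1.
Qed.

Lemma cube_funK k (L : @little_cube R k) : cancel (cube_fun L) (cube_inv L).
Proof.
move=> t; apply/rowP => i; rewrite !mxE addrK mulrC mulKf //.
exact: slope_neq0.
Qed.

Lemma cube_invK k (L : @little_cube R k) : cancel (cube_inv L) (cube_fun L).
Proof.
move=> t; apply/rowP => i; rewrite !mxE mulrC divfK ?subrK //.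
exact: slope_neq0.
Qed.

Lemma unit_cube_fun k (L : @little_cube R k) t :
  unit_cube t -> unit_cube (cube_fun L t).
Proof. by move=> ut i; rewrite !mxE; exact/little_cube_sub/ut. Qed.

Lemma col'_cube_fun k c (L : @little_cube R k.+1) t :
  col' c (cube_fun L t) = cube_fun (face c L) (col' c t).
Proof. by apply/rowP => i; rewrite !mxE. Qed.

Lemma col'_cube_inv k c (L : @little_cube R k.+1) t :
  col' c (cube_inv L t) = cube_inv (face c L) (col' c t).
Proof. by apply/rowP => i; rewrite !mxE. Qed.

Lemma little_cubes_disjoint k j (L : 'I_j -> @little_cube R k) i i' t :
  little_cubes L -> open_cube (cube_inv (L i) t) ->
  open_cube (cube_inv (L i') t) -> i = i'.
Proof.
by move=> Ld it i't; have [] := Ld i i' _ _ it i't; rewrite ?cube_invK.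
Qed.

(* Cubes with the same initial point along c overlap in that coordinate, so
   it is the faces that have disjoint interiors. *)
Lemma face_disjoint k j c (L : 'I_j -> @little_cube R k.+1) i i' t :
  little_cubes L -> initial c (L i) = initial c (L i') ->
  open_cube (cube_inv (face c (L i)) t) ->
  open_cube (cube_inv (face c (L i')) t) -> i = i'.
Proof.
move=> Ld ii' it i't.
(* The c-th interval of a cube is twice as long as its slope, so the point at distance e beyond the
   common initial point is interior to both intervals. *)
pose e := Num.min (slope (L i) c) (slope (L i') c).
have e0 : 0 < e by rewrite lt_min !slope_gt0.
pose x l := (initial c (L l) + e - offset (L l) c) / slope (L l) c.
have xE l : x l = -1 + e / slope (L l) c.
  rewrite /x /initial mulrN1 addrAC addrK mulrDl mulNr divff //.
  exact: slope_neq0.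
have xl l : e <= slope (L l) c -> -1 < x l < 1.
  move=> el; rewrite xE ltrDl divr_gt0 ?slope_gt0 //= addrC ltrBlDr.
  by rewrite (@le_lt_trans _ _ 1) ?ltrDl // ler_pdivrMr ?slope_gt0 // mul1r.
have open_x l : e <= slope (L l) c -> open_cube (cube_inv (face c (L l)) t) ->
    open_cube (cube_inv (L l) (insert_coord c (initial c (L l) + e) t)).
  move=> el lt i0; rewrite !mxE; case: unliftP => [a|] ->; last exact: xl.
  by have := lt a; rewrite mxE.
apply: (little_cubes_disjoint (t := insert_coord c (initial c (L i) + e) t) Ld).
  by apply: open_x; rewrite // ge_min lexx.
by rewrite ii'; apply: open_x; rewrite // ge_min lexx orbT.
Qed.

End Cubes.

(** * The actions on EC and PEC are well defined *)

Section CubeActions.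
Context {R : realType} {m : nat} {M : manifold R m}.
Notation space k := ('rV[R]_k * M)%type.
Implicit Types k n : nat.

Lemma smooth_embedding_id k : smooth_embedding (id : space k -> space k).
Proof.
have ids : smooth_map (id : space k -> space k).
  have := @smooth_map_affine R m M k k id idfun 0 (fun t => esym (addr0 t)).
  by congr smooth_map; apply/funext => -[].
exact: (smooth_embedding_cancel ids ids).
Qed.

Lemma smooth_embedding_cube_act k (L : @little_cube R k) (f : weak_map k k M) :
  smooth_embedding f -> smooth_embedding (cube_act L f).
Proof.
move=> fe; pose up (p : space k) : space k := (cube_fun L p.1, p.2).
pose dn (p : space k) : space k := (cube_inv L p.1, p.2).
have upK : cancel up dn by move=> [t v]; rewrite /up /dn /= cube_funK.
have dnK : cancel dn up by move=> [t v]; rewrite /up /dn /= cube_invK.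
have ups : smooth_map up.
  have sl : linear (fun t : 'rV[R]_k => \row_i (slope L i * t ord0 i)).
    move=> a t t'; apply/rowP => i; rewrite !mxE mulrDr; congr (_ + _).
    by rewrite mulrCA.
  pose A : {linear 'rV[R]_k -> 'rV[R]_k} :=
    HB.pack (fun t : 'rV[R]_k => \row_i (slope L i * t ord0 i))
      (GRing.isLinear.Build _ _ _ _ _ sl).
  apply: (smooth_map_affine (A := A) (b := \row_i offset L i)) => t.
  by apply/rowP => i; rewrite !mxE.
have dns : smooth_map dn.
  have sl : linear (fun t : 'rV[R]_k => \row_i (t ord0 i / slope L i)).
    move=> a t t'; apply/rowP => i; rewrite !mxE mulrDl; congr (_ + _).
    by rewrite mulrA.
  pose A : {linear 'rV[R]_k -> 'rV[R]_k} :=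
    HB.pack (fun t : 'rV[R]_k => \row_i (t ord0 i / slope L i))
      (GRing.isLinear.Build _ _ _ _ _ sl).
  apply: (smooth_map_affine (A := A)
    (b := \row_i (- offset L i / slope L i))) => t.
  by apply/rowP => i; rewrite !mxE mulrDl.
rewrite -[cube_act L f]/(up \o (f \o dn)).
apply: smooth_embedding_comp; last exact: smooth_embedding_cancel ups dns upK.
by apply: smooth_embedding_comp fe; exact: smooth_embedding_cancel dns ups dnK.
Qed.

Lemma moved_cube_act k (L : @little_cube R k) (f : weak_map k k M) p :
  moved (cube_act L f) p -> moved f (cube_inv L p.1, p.2).
Proof.
move=> Lp fp; apply: Lp; rewrite /cube_act /= fp /= cube_invK.
by rewrite -surjective_pairing.
Qed.

Lemma EC_id k : EC k M (id : weak_map k k M).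
Proof. by split=> //; exact: smooth_embedding_id. Qed.

Lemma EC_comp k (f g : weak_map k k M) : EC k M f -> EC k M g ->
  EC k M (f \o g).
Proof.
move=> [fe fu] [ge gu]; split; first exact: smooth_embedding_comp.
move=> p fgp; have [gp|/gu //] := pselect (g p = p).
by apply: fu => fp; apply: fgp; rewrite /= gp.
Qed.

Lemma EC_cube_act k (L : @little_cube R k) f : EC k M f ->
  EC k M (cube_act L f).
Proof.
move=> [fe fu]; split; first exact: smooth_embedding_cube_act.
by move=> p /moved_cube_act/fu /= /(unit_cube_fun L); rewrite cube_invK.
Qed.

Lemma PEC_comp n (c : 'I_n.+1) (f g : weak_map n.+1 n.+1 M) :
  PEC c M f -> PEC c M g -> PEC c M (f \o g).
Proof.
move=> [fe fu [f' f'E ff']] [ge gu [g' g'E gg']]; split.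
- exact: smooth_embedding_comp.
- move=> p fgp; have [gp|/gu //] := pselect (g p = p).
  by apply: fu => fp; apply: fgp; rewrite /= gp.
- exists (f' \o g'); first exact: EC_comp.
  by move=> x t v x1; rewrite /= gg' // ff' // -surjective_pairing.
Qed.

(** The c-th factor of L sends 1 to a point at most 1 and has slope at most 1, so its inverse maps
    [1, oo) into itself, where f is a product. *)
Lemma cube_act_add_coord n (c : 'I_n.+1) (L : @little_cube R n.+1)
    (f : weak_map n.+1 n.+1 M) (g : weak_map n n M) :
  (forall x t v, 1 <= x -> f (insert_coord c x t, v) =
     (insert_coord c x (g (t, v)).1, (g (t, v)).2)) ->
  forall x t v, 1 <= x -> cube_act L f (insert_coord c x t, v) =
    (insert_coord c x (cube_act (face c L) g (t, v)).1,
     (cube_act (face c L) g (t, v)).2).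
Proof.
move=> fg x t v x1; pose y := (x - offset L c) / slope L c.
have y1 : 1 <= y.
  rewrite /y ler_pdivlMr ?slope_gt0 // mul1r lerBrDr.
  exact: le_trans (slope_offset_le L c) x1.
have invE : cube_inv L (insert_coord c x t) =
    insert_coord c y (cube_inv (face c L) t).
  by apply/rowP => i; rewrite !mxE; case: unliftP => [a|] ->; rewrite ?mxE.
rewrite /cube_act /= invE fg //=; congr pair; apply/rowP => i.
rewrite !mxE; case: unliftP => [a|] ->; rewrite ?mxE //.
by rewrite /y mulrC divfK ?subrK // slope_neq0.
Qed.

Lemma PEC_cube_act n (c : 'I_n.+1) (L : @little_cube R n.+1) f :
  PEC c M f -> PEC c M (cube_act L f).
Proof.
move=> [fe fu [g gE fg]]; split; first exact: smooth_embedding_cube_act.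
  move=> p /moved_cube_act/fu[/= pc pu]; split; last first.
    by move: pu => /(unit_cube_fun (face c L)); rewrite col'_cube_inv cube_invK.
  (* The support now starts at the image of -1 under the c-th factor of L, which is at least -1. *)
  move: pc; rewrite mxE ler_pdivlMr ?slope_gt0 // lerBrDr; apply: le_trans.
  by rewrite mulrC; exact: initial_ge.
exists (cube_act (face c L) g); first exact: EC_cube_act.
exact: cube_act_add_coord.
Qed.

Lemma space_hausdorff k : hausdorff_space (space k).
Proof.
by apply: hausdorff_pair; [exact: norm_hausdorff|exact: manifold_hausdorff].
Qed.

Lemma embedding_moved_open k (f : weak_map k k M) :
  smooth_embedding f -> open (moved f).
Proof. by move=> [_ _ [_ fc _]]; apply: moved_open fc; exact: space_hausdorff.
  Qed.

Lemma embedding_inj k (f : weak_map k k M) : smooth_embedding f -> injective f.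
Proof. by move=> [_ _ []]. Qed.

Lemma near_coord_line k (U : set (space k)) (p : space k) i :
  open U -> U p -> exists2 e : R, 0 < e &
    U (p.1 + e *: delta_mx ord0 i, p.2) /\ U (p.1 - e *: delta_mx ord0 i, p.2).
Proof.
move=> oU Up.
have hc : h *: delta_mx ord0 i @[h --> (0 : R)] --> (0 : 'rV[R]_k).
  rewrite -[X in _ --> X](scale0r (delta_mx ord0 i)).
  by apply: cvgZr_tmp; exact: cvg_id.
have l1 : p.1 + h *: delta_mx ord0 i @[h --> (0 : R)] --> p.1 + 0.
  exact: cvgD (cvg_cst p.1) hc.
have lc : (p.1 + h *: delta_mx ord0 i, p.2) @[h --> (0 : R)] --> (p.1 + 0, p.2).
  exact: cvg_pair l1 (cvg_cst p.2).
rewrite addr0 -surjective_pairing in lc.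
have [e /= e0 eU] := lc _ (open_nbhs_nbhs (conj oU Up)).
have e2 : 0 < e / 2 by rewrite divr_gt0.
have ee : `|e / 2| < e by rewrite gtr0_norm // ltr_pdivrMr // ltr_pMr // ltr1n.
exists (e / 2) => //; split; first by apply: eU; rewrite /= sub0r normrN.
by rewrite -scaleNr; apply: eU; rewrite /= sub0r opprK.
Qed.

(** A point of U on one of the bounds could be pushed beyond it along the i-th direction without
    leaving the open set U. *)
Lemma open_coord_bounds k (U : set (space k)) i a b :
  open U -> (forall p, U p -> a <= p.1 ord0 i <= b) ->
  forall p, U p -> a < p.1 ord0 i < b.
Proof.
move=> oU Uab p Up; have [e e0 [/Uab + /Uab]] := near_coord_line i oU Up.
rewrite /= !mxE !eqxx mulr1 => /andP[_ hb] /andP[ha _]; apply/andP; split.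
  by apply: le_lt_trans ha _; rewrite ltrBlDr ltrDl.
by apply: lt_le_trans hb; rewrite ltrDl.
Qed.

Lemma EC_moved k (f : weak_map k k M) p :
  EC k M f -> moved f p -> open_cube p.1.
Proof.
move=> [fe fu] fp i.
by apply: (open_coord_bounds (embedding_moved_open fe)) fp => q /fu.
Qed.

Lemma PEC_moved n (c : 'I_n.+1) (f : weak_map n.+1 n.+1 M) p :
  PEC c M f -> moved f p -> open_cube (col' c p.1).
Proof.
move=> [fe fu _] fp i; rewrite mxE.
apply: (open_coord_bounds (embedding_moved_open fe)) fp => q /fu[_ /(_ i)].
by rewrite mxE.
Qed.

(** The support lies over the open cube and misses the points whose c-th coordinate is at least 1,
    so the restriction required there is the identity. *)
Lemma EC_sub_PEC n (c : 'I_n.+1) : EC n.+1 M `<=` PEC c M.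
Proof.
move=> f fE; have [fe fu] := fE; split=> //.
  by move=> p /fu pu; split; [case/andP: (pu c)|move=> i; rewrite mxE;
    exact: pu].
exists id; first exact: EC_id.
move=> x t v x1 /=; apply: contrapT => fp.
have /andP[_] := EC_moved fE fp c; rewrite insert_coord_same ltNge => /negP.
exact.
Qed.

Lemma cube_act_comm k j (L : 'I_j -> @little_cube R k) (f : 'I_j ->
  weak_map k k M) :
  little_cubes L -> (forall i, EC k M (f i)) -> forall a b,
  cube_act (L a) (f a) \o cube_act (L b) (f b) =
  cube_act (L b) (f b) \o cube_act (L a) (f a).
Proof.
move=> Ld fE a b; have [->//|ab] := eqVneq a b.
have fi i : injective (cube_act (L i) (f i)).
  by apply: embedding_inj; apply: smooth_embedding_cube_act; case: (fE i).
apply: comp_disjoint_support => // p /moved_cube_act/(EC_moved (fE a)) /= pa.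
move=> /moved_cube_act/(EC_moved (fE b)) /= pb.
by move/eqP: ab; apply; exact: little_cubes_disjoint pa pb.
Qed.

Lemma face_act_comm k j c (L : 'I_j -> @little_cube R k.+1)
    (f : 'I_j -> weak_map k k M) :
  little_cubes L -> (forall i, EC k M (f i)) -> forall a b,
  initial c (L a) = initial c (L b) ->
  cube_act (face c (L a)) (f a) \o cube_act (face c (L b)) (f b) =
  cube_act (face c (L b)) (f b) \o cube_act (face c (L a)) (f a).
Proof.
move=> Ld fE a b cab; have [->//|ab] := eqVneq a b.
have fi i : injective (cube_act (face c (L i)) (f i)).
  by apply: embedding_inj; apply: smooth_embedding_cube_act; case: (fE i).
apply: comp_disjoint_support => // p /moved_cube_act/(EC_moved (fE a)) /= pa.
move=> /moved_cube_act/(EC_moved (fE b)) /= pb.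
by move/eqP: ab; apply; exact: face_disjoint cab pa pb.
Qed.

(** The supports may be unbounded along c, so they are separated in the other coordinates: they lie
    over the interiors of the faces, which are disjoint when the initial points agree. *)
Lemma PEC_act_comm n j (c : 'I_n.+1) (L : 'I_j -> @little_cube R n.+1)
    (f : 'I_j -> weak_map n.+1 n.+1 M) :
  little_cubes L -> (forall i, PEC c M (f i)) -> forall a b,
  initial c (L a) = initial c (L b) ->
  cube_act (L a) (f a) \o cube_act (L b) (f b) =
  cube_act (L b) (f b) \o cube_act (L a) (f a).
Proof.
move=> Ld fE a b cab; have [->//|ab] := eqVneq a b.
have fi i : injective (cube_act (L i) (f i)).
  by apply: embedding_inj; apply: smooth_embedding_cube_act; case: (fE i).
apply: comp_disjoint_support => // p /moved_cube_act/(PEC_moved (fE a)).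
rewrite /= col'_cube_inv => pa /moved_cube_act/(PEC_moved (fE b)).
rewrite /= col'_cube_inv => pb.
by move/eqP: ab; apply; exact: face_disjoint cab pa pb.
Qed.

Lemma EC_ordered_comp k j (s : {perm 'I_j}) (f : 'I_j -> weak_map k k M) :
  (forall i, EC k M (f i)) -> EC k M (ordered_comp s f).
Proof.
by move=> fE; apply: ordered_comp_closed fE; [exact: EC_id|exact: EC_comp].
Qed.

Lemma concatenation_action k : cubes_action (EC k M) (concatenation k M).
Proof.
move=> j L f Ld fE; exists (ordered_comp 1 (fun i => cube_act (L i) (f i))) =>
  //.
by apply: EC_ordered_comp => i; exact: EC_cube_act.
Qed.

Lemma kappa_action k (c : 'I_k.+1) : cubes_action (EC k M) (kappa c M).
Proof.
move=> j L f Ld fE.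
have [s so kE] := ordered_comp_set1 (key := fun i => initial c (L i))
  (face_act_comm Ld fE).
exists (ordered_comp s (fun i => cube_act (face c (L i)) (f i))) => //.
by apply: EC_ordered_comp => i; exact: EC_cube_act.
Qed.

Lemma PEC_action n (c : 'I_n.+1) : cubes_action (PEC c M) (PEC_operation c M).
Proof.
move=> j L f Ld fE.
have [s so kE] := ordered_comp_set1 (key := fun i => initial c (L i))
  (PEC_act_comm Ld fE).
exists (ordered_comp s (fun i => cube_act (L i) (f i))) => //.
apply: (ordered_comp_closed (P := PEC c M)) => [|g h|i];
  first exact/EC_sub_PEC/EC_id.
  exact: PEC_comp.
exact: PEC_cube_act.
Qed.

(** On EC all the factors commute, so the order of the indices and the order of the initial points
    give the same composite. *)
Lemma concatenation_PEC n (c : 'I_n.+1) j (L : 'I_j -> @little_cube R n.+1)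
    (f : 'I_j -> weak_map n.+1 n.+1 M) :
  little_cubes L -> (forall i, EC n.+1 M (f i)) ->
  concatenation n.+1 M j L f = PEC_operation c M j L f.
Proof.
move=> Ld fE.
have [s so kE] := ordered_comp_set1 (key := fun i => initial c (L i))
  (PEC_act_comm Ld (fun i => EC_sub_PEC c (fE i))).
rewrite [RHS]kE /concatenation.
(* For a constant key every permutation is an ordering, which turns full commutativity into an
   instance of [ordered_comp_unique]. *)
have comm a b (_ : (0 : R) = 0) := cube_act_comm Ld fE a b.
have const_ordering (r : {perm 'I_j}) : ordering (fun=> 0 : R) r by move=> a b
  _; exact: lexx.
by rewrite (ordered_comp_unique comm (const_ordering 1%g) (const_ordering s)).
Qed.

End CubeActions.

(** * Equivariance of the projection and of graphing *)

Section Equivariance.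
Context {R : realType} {m : nat} {M : manifold R m}.
Notation space k := ('rV[R]_k * M)%type.
Implicit Types k n : nat.

(** The map g in the definition of [PEC] is determined by f, as its restriction at x = 1. *)
Lemma PEC_projP n (c : 'I_n.+1) (f : weak_map n.+1 n.+1 M) : PEC c M f ->
  EC n M (PEC_proj c M f) /\
  forall x p, 1 <= x -> f (add_coord c x p) = add_coord c x (PEC_proj c M f p).
Proof.
move=> [_ _ [g gE fg]].
have -> : PEC_proj c M f = g.
  apply/funext => -[t v]; rewrite /PEC_proj /= fg //= insert_coordK.
  by rewrite -surjective_pairing.
by split=> // x [t v] x1; rewrite /add_coord /= fg.
Qed.

(** The map g preserves the hyperplane where the c-th coordinate is 1. *)
Lemma PEC_proj_comp n (c : 'I_n.+1) (f g : weak_map n.+1 n.+1 M) :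
  PEC c M g -> PEC_proj c M (f \o g) = PEC_proj c M f \o PEC_proj c M g.
Proof.
move=> /PEC_projP[_ gE]; apply/funext => p.
rewrite -[LHS]/(drop_coord c (f (g (add_coord c 1 p)))) gE //.
Qed.

Lemma PEC_proj_id n (c : 'I_n.+1) :
  PEC_proj c M (id : weak_map n.+1 n.+1 M) = id.
Proof. by apply/funext => p; exact: (add_coordK c 1 p). Qed.

Lemma PEC_proj_cube_act n (c : 'I_n.+1) (L : @little_cube R n.+1)
    (f : weak_map n.+1 n.+1 M) : PEC c M f ->
  PEC_proj c M (cube_act L f) = cube_act (face c L) (PEC_proj c M f).
Proof.
move=> fE; have [gE fg] := PEC_projP fE; apply/funext => -[t v].
have fg' x u w : 1 <= x -> f (insert_coord c x u, w) =
    (insert_coord c x (PEC_proj c M f (u, w)).1, (PEC_proj c M f (u, w)).2).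
  by move=> x1; exact: (fg x (u, w) x1).
by rewrite {1}/PEC_proj (cube_act_add_coord L fg') //= insert_coordK.
Qed.

Lemma PEC_proj_ordered_comp n (c : 'I_n.+1) j (s : {perm 'I_j})
    (f : 'I_j -> weak_map n.+1 n.+1 M) :
  (forall i, PEC c M (f i)) ->
  PEC_proj c M (ordered_comp s f) = ordered_comp s (PEC_proj c M \o f).
Proof.
move=> fE; rewrite !ordered_compE; move: [seq _ | _ <- _] => l.
suff [] : PEC c M (seq_comp f l) /\
  PEC_proj c M (seq_comp f l) = seq_comp (PEC_proj c M \o f) l by [].
elim: l => [|i l [lE IHl]] /=.
  by split; [exact/EC_sub_PEC/EC_id|exact: PEC_proj_id].
by split; [exact: PEC_comp|rewrite PEC_proj_comp // IHl].
Qed.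

(** Both operations order the cubes by the same key, so the same permutations are admissible on the
    two sides. *)
Lemma PEC_proj_operation n (c : 'I_n.+1) j (L : 'I_j -> @little_cube R n.+1)
    (f : 'I_j -> weak_map n.+1 n.+1 M) :
  (forall i, PEC c M (f i)) ->
  PEC_proj c M @` PEC_operation c M j L f =
  kappa c M j L (PEC_proj c M \o f).
Proof.
move=> fE.
have E s : PEC_proj c M (ordered_comp s (fun i => cube_act (L i) (f i))) =
    ordered_comp s (fun i => cube_act (face c (L i)) (PEC_proj c M (f i))).
  rewrite PEC_proj_ordered_comp; last by move=> i; exact: PEC_cube_act.
  by congr ordered_comp; apply/funext => i; exact: PEC_proj_cube_act.
apply/seteqP; split=> g.
  by move=> [_ [s so ->] <-]; exists s => //; rewrite E.
move=> [s so ->]; exists (ordered_comp s (fun i => cube_act (L i) (f i))) => //.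
by exists s.
Qed.

Lemma adjointE n (F : Defs.family n M) :
  adjoint F = drop_coord ord0 \o graphing M F.
Proof.
by apply/funext => p; apply/esym;
  exact: (add_coordK ord0 (p.1 ord0 ord0) (adjoint F p)).
Qed.

Lemma adjoint_add_coord n (F : Defs.family n M) x p :
  adjoint F (add_coord ord0 x p) = F x p.
Proof.
rewrite /adjoint add_coord_fst; congr (F x _).
by rewrite /= insert_coordK -surjective_pairing.
Qed.

(** This allows identities between loops to be checked on their graphs. *)
Lemma graphing_inj n : injective (@graphing R m n M).
Proof.
move=> F G FG; apply/funext => x; apply/funext => p.
by rewrite -!adjoint_add_coord !adjointE FG.
Qed.

Lemma graphing_id n : graphing M (fun=> id : weak_map n n M) = id.
Proof. by apply/funext => p; exact: (drop_coordK ord0 p). Qed.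

Lemma graphing_comp n (F G : Defs.family n M) :
  graphing M (fun x => F x \o G x) = graphing M F \o graphing M G.
Proof.
apply/funext => p; rewrite /graphing /= insert_coord_same insert_coordK.
by rewrite -surjective_pairing.
Qed.

Lemma graphing_ordered_comp n j (s : {perm 'I_j}) (F : 'I_j ->
  Defs.family n M) :
  graphing M (fun x => ordered_comp s (fun i => F i x)) =
  ordered_comp s (fun i => graphing M (F i)).
Proof.
rewrite ordered_compE.
have -> : (fun x => ordered_comp s (fun i => F i x)) =
    fun x => seq_comp (fun i => F i x) [seq s i | i <- index_enum 'I_j].
  by apply/funext => x; rewrite ordered_compE.
elim: [seq _ | _ <- _] => [|i l IHl] /=; first exact: graphing_id.
by rewrite -IHl graphing_comp.
Qed.

(** The first and last coordinates may be dropped in either order; slopes and offsets are compared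
    separately because a cube also carries proofs. *)
Lemma face_swap n (L : @little_cube R n.+2) :
  (slope (face ord_max (face ord0 L)) = slope (face ord0 (face ord_max L))) *
  (offset (face ord_max (face ord0 L)) = offset (face ord0 (face ord_max L))).
Proof.
have E (i : 'I_n) : lift ord0 (lift ord_max i) = lift ord_max (lift ord0 i).
  by apply: ord_inj; rewrite lift0 !lift_max lift0.
by split; apply/funext => i /=; rewrite E.
Qed.

(** On graphs, reparametrising the loop is conjugation in the coordinate t_0; together with the
    action on the other coordinates it is the action of L without its last factor. *)
Lemma graphing_cube_act n (L : @little_cube R n.+2) (F : Defs.family n M) :
  graphing M (fun x =>
    cube_act (face ord_max (face ord0 L)) (loop_act L F x)) =
  cube_act (face ord_max L) (graphing M F).
Proof.
apply/funext => -[t v]; rewrite /graphing /cube_act /=.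
have [sE oE] := face_swap L.
have invE u : cube_inv (face ord_max (face ord0 L)) u =
    cube_inv (face ord0 (face ord_max L)) u by rewrite /cube_inv sE oE.
have funE u : cube_fun (face ord_max (face ord0 L)) u =
    cube_fun (face ord0 (face ord_max L)) u by rewrite /cube_fun sE oE.
have l0 : lift ord_max ord0 = ord0 :> 'I_n.+2 by exact: val_inj.
rewrite invE funE -col'_cube_inv /loop_act.
have -> : (t ord0 ord0 - offset L ord0) / slope L ord0 =
    cube_inv (face ord_max L) t ord0 ord0 by rewrite !mxE /= l0.
congr pair; set q := F _ _.
rewrite -[RHS](@col'K R n ord0) col'_cube_fun insert_coordK.
congr insert_coord.
by rewrite !mxE unlift_none /= l0 mulrC divfK ?subrK // slope_neq0.
Qed.

Hypothesis Mcompact : compact [set: M].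

Lemma compact_unit_cube k : compact [set p : space k | unit_cube p.1].
Proof.
have -> : [set p : space k | unit_cube p.1] = @unit_cube R k `*` [set: M].
  by apply/seteqP; split=> p; [move=> ?; split|move=> []].
apply: compact_setX => //.
have := @rV_compact R k (fun=> `[-1, 1]%classic) (fun=> @segment_compact R _ _).
congr compact; apply/seteqP; split=> t /= h i; have := h i; by rewrite in_itv.
Qed.

Lemma graphing_EC n (F : Defs.family n M) : loopEC n M F ->
  EC n.+1 M (graphing M F).
Proof.
move=> [Fs FE Fid].
have Funit p : moved (graphing M F) p -> unit_cube p.1.
  move=> Fp; pose q := drop_coord ord0 p.
  have Fq : F (p.1 ord0 ord0) q <> q.
    by move=> Fq; apply: Fp; rewrite /graphing Fq; exact: (drop_coordK ord0 p).
  have qu : unit_cube q.1 by case: (FE (p.1 ord0 ord0)) => _; exact.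
  move=> i; case: (unliftP ord0 i) => [j|] ->.
    by have := qu j; rewrite mxE.
  by apply: contrapT => /Fid F1; apply: Fq; rewrite F1.
split=> //; have gs := smooth_map_graph ord0 Fs; split.
- exact: gs.
- apply: immersion_graph => // x.
  rewrite (_ : _ \o _ = F x); first by case: (FE x) => -[].
  by apply/funext => p; exact: adjoint_add_coord.
- apply: (compact_support_embedding _ _ _ (@compact_unit_cube n.+1)) => //.
  + exact: space_hausdorff.
  + by case: gs.
  + move=> p q pq.
    (* The graph preserves t_0, so injectivity reduces to that of a single embedding of the loop. *)
    have pq0 : p.1 ord0 ord0 = q.1 ord0 ord0.
      have := congr1 (fun r : space n.+1 => r.1 ord0 ord0) pq.
      by rewrite /graphing /= !insert_coord_same.
    rewrite -(drop_coordK ord0 p) -(drop_coordK ord0 q) pq0; congr add_coord.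
    apply: (embedding_inj (proj1 (FE (q.1 ord0 ord0)))).
    have := congr1 (drop_coord ord0) pq.
    rewrite -[LHS]/((drop_coord ord0 \o graphing M F) p).
    rewrite -[RHS]/((drop_coord ord0 \o graphing M F) q) -adjointE.
    by rewrite -[X in adjoint F X](drop_coordK ord0 p) -[X in _ = adjoint F
      X](drop_coordK ord0 q)
      !adjoint_add_coord pq0.
Qed.

Lemma graphing_loop_act n j (s : {perm 'I_j}) (L : 'I_j -> @little_cube R n.+2)
    (F : 'I_j -> Defs.family n M) :
  graphing M (fun x => ordered_comp s (fun i =>
      cube_act (face ord_max (face ord0 (L i))) (loop_act (L i) (F i) x))) =
  ordered_comp s (fun i => cube_act (face ord_max (L i)) (graphing M (F i))).
Proof.
rewrite (graphing_ordered_comp s (fun i x =>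
  cube_act (face ord_max (face ord0 (L i))) (loop_act (L i) (F i) x))).
by congr ordered_comp; apply/funext => i; exact: graphing_cube_act.
Qed.

Lemma initial_face0 n (L : @little_cube R n.+2) :
  initial ord_max (face ord0 L) = initial ord_max L.
Proof.
have lE : lift ord0 ord_max = ord_max :> 'I_n.+2 by exact: val_inj.
by rewrite /initial /= lE.
Qed.

(** Both the independence of the permutation and the smoothness of the composite loop are
    transferred from graphs, where the factors are elements of EC. *)
Lemma loop_action n : cubes_action (loopEC n M) (loop_operation n M).
Proof.
move=> j L F Ld FE.
have gE i := graphing_EC (FE i).
have comm := face_act_comm (c := ord_max) Ld gE.
have [s so] := ordering_exists (fun i => initial ord_max (face ord0 (L i))).
have max_ordering (r : {perm 'I_j}) :
    ordering (fun i => initial ord_max (face ord0 (L i))) r ->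
    ordering (fun i => initial ord_max (L i)) r.
  by move=> ro a b ab; have := ro a b ab; rewrite !initial_face0.
pose y : Defs.family n M := fun x => ordered_comp s (fun i =>
  cube_act (face ord_max (face ord0 (L i))) (loop_act (L i) (F i) x)).
exists y; last first.
  apply/seteqP; split=> g; last by move=> ->; exists s.
  move=> [s' s'o ->]; apply: graphing_inj; rewrite !graphing_loop_act.
  exact: (ordered_comp_unique (key := fun i => initial ord_max (L i))
    (f := fun i => cube_act (face ord_max (L i)) (graphing M (F i)))
    comm (max_ordering _ s'o) (max_ordering _ so)).
have yE : EC n.+1 M (graphing M y).
  rewrite graphing_loop_act; apply: EC_ordered_comp => i; exact: EC_cube_act.
split.
- rewrite adjointE; apply: smooth_map_comp (smooth_map_drop_coord _).
  by case: yE => -[].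
- move=> x; apply: EC_ordered_comp => i; apply: EC_cube_act.
  by have [_ + _] := FE i; exact.
- move=> x x1; rewrite /y ordered_compE.
  elim: [seq _ | _ <- _] => //= i l ->.
  (* The first factor of L maps [-1, 1] into itself, so a parameter outside it is pulled back
     outside it. *)
  have -> : loop_act (L i) (F i) x = id.
    have [_ _] := FE i; apply=> u1; apply: x1.
    have := little_cube_sub (L i) ord0 u1.
    by rewrite mulrC divfK ?subrK // slope_neq0.
  apply/funext => p; rewrite /cube_act /= cube_invK.
  by rewrite -surjective_pairing.
Qed.

Lemma graphing_operation n j (L : 'I_j -> @little_cube R n.+2)
    (F : 'I_j -> Defs.family n M) :
  graphing M @` loop_operation n M j L F =
  kappa ord_max M j L (graphing M \o F).
Proof.
apply/seteqP; split=> g.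
  move=> [_ [s so ->] <-]; exists s; last exact: graphing_loop_act.
  by move=> a b ab; have := so a b ab; rewrite !initial_face0.
move=> [s so ->]; exists (fun x => ordered_comp s (fun i =>
  cube_act (face ord_max (face ord0 (L i))) (loop_act (L i) (F i) x))).
  exists s => // a b ab; have := so a b ab; by rewrite !initial_face0.
exact: graphing_loop_act.
Qed.

End Equivariance.

(** * Continuity in the weak topology *)

Section WeakTopology.
Context {R : realType} {m : nat} {M : manifold R m}.
Notation model k := ('rV[R]_k * 'rV[R]_m)%type.
Notation space k := ('rV[R]_k * M)%type.
Implicit Types k n : nat.

Lemma weak_subbase_open k l (N : set (weak_map k l M)) :
  @weak_subbase R m k l M N -> open N.
Proof.
move=> NS; exists [set N]; last by rewrite bigcup_set1.
by move=> _ ->; exact: (@finI_from1 _ _ (@weak_subbase R m k l M) id).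
Qed.

(** Open sets are unions of finite intersections of basic neighbourhoods, so continuity is tested on
    the latter. *)
Lemma within_continuous_weak k l (T : topologicalType) (X : set T)
    (phi : T -> weak_map k l M) :
  (forall N x, @weak_subbase R m k l M N -> X x -> N (phi x) ->
     \forall y \near x, X y -> N (phi y)) ->
  {within X, continuous phi}.
Proof.
move=> phiN; apply/subspace_continuousP => x Xx A.
rewrite nbhsE => -[B [[D' D'f <-] [B0 B0D B0x]] BA].
have [E EN B0E] := D'f _ B0D.
suff : within X (nbhs x) (phi @^-1` B0).
  by apply: filterS => y By; apply: BA; exists B0.
rewrite -B0E; rewrite -B0E in B0x.
apply: (@filter_bigI_within _ _ E (fun N => phi @^-1` N)) => N NE.
by apply: phiN => //; [have := EN N NE; rewrite inE|exact: B0x].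
Qed.

Lemma row_norm_le n (t : 'rV[R]_n) e : 0 <= e ->
  `|t| <= e <-> forall i, `|t ord0 i| <= e.
Proof.
move=> e0; rewrite [`|t|]/Num.norm /= mx_normrE; split.
  by move=> /bigmax_leP[_ te] i; exact: (te (ord0, i)).
by move=> te; apply/bigmax_leP; split=> // -[i j] _; rewrite ord1; exact: te.
Qed.

Lemma drop_coord_norm n (c : 'I_n.+1) (v : model n.+1) :
  `|v| <= 1 -> `|drop_coord c v| <= 1.
Proof.
rewrite !prod_normE /= !ge_max => /andP[/(row_norm_le _ ler01) v1 ->].
rewrite andbT; apply/(row_norm_le _ ler01) => i; rewrite mxE; exact: v1.
Qed.

Lemma add_coord_norm n (c : 'I_n.+1) (v : model n) :
  `|v| <= 1 -> `|add_coord c 0 v| <= 1.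
Proof.
rewrite !prod_normE /= !ge_max => /andP[/(row_norm_le _ ler01) v1 ->].
rewrite andbT; apply/(row_norm_le _ ler01) => i; rewrite mxE.
by case: unliftP => [j|] _ //; rewrite normr0.
Qed.

(** Derivatives commute with the two linear projections, and the norm is the maximum of the norms of
    the two components. *)
Lemma iter_derive_in_components n k (c : 'I_n.+1) (f g : model k -> model n.+1)
    x s e :
  0 < e -> @model_dom R m k x -> smooth_at (@model_dom R m k) f x ->
  smooth_at (@model_dom R m k) g x ->
  `|iter_derive_in (@model_dom R m k) s f x -
    iter_derive_in (@model_dom R m k) s g x| < e <->
  `|iter_derive_in (@model_dom R m k) s (model_coord (inl c) \o f) x -
    iter_derive_in (@model_dom R m k) s (model_coord (inl c) \o g) x| < e /\
  `|iter_derive_in (@model_dom R m k) s (drop_coord c \o f) x -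
    iter_derive_in (@model_dom R m k) s (drop_coord c \o g) x| < e.
Proof.
move=> e0 Dx fs gs.
have Da := @model_dom_accessible R k m.
have mc := @model_linear_continuous R _ _ _ (@model_coord R n.+1 m (inl c)).
have dc := @model_linear_continuous R _ _ _ (@drop_coord R n 'rV[R]_m c).
rewrite (iter_derive_in_linear s Da mc Dx fs) (iter_derive_in_linear s Da mc Dx
  gs).
rewrite (iter_derive_in_linear s Da dc Dx fs) (iter_derive_in_linear s Da dc Dx
  gs).
rewrite -(raddfB (@model_coord R n.+1 m (inl c))).
rewrite -(raddfB (@drop_coord R n 'rV[R]_m c)).
exact: model_norm_lt.
Qed.

Lemma smooth_local_rep k l (f : space k -> space l) (phi psi : chart R m M) p :
  smooth_map f -> atlas phi -> atlas psi -> chart_dom phi p.2 ->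
  chart_dom psi (f p).2 ->
  smooth_at (@model_dom R m k) (local_rep phi psi f) (local_point phi p).
Proof. by move=> [_ fs]; exact: fs. Qed.

(* The 0-th component of the derivatives of [graphing M F] does not depend on F,
   and the other ones are those of [adjoint F]. *)
Lemma graphing_continuous n : {within loopEC n M, continuous (@graphing R m n
  M)}.
Proof.
apply: within_continuous_weak => N0 F1 [f0 [phi [psi [K [r [e]]]]]].
move=> [f0s [aphi apsi] [Kc e0] Kd ->] F1E NF1.
pose N := weak_nbhd (drop_coord ord0 \o f0 : weak_map n.+1 n M) phi psi K r e.
have No : open N.
  apply: weak_subbase_open.
  exists (drop_coord ord0 \o f0), phi, psi, K, r, e; split=> //.
  exact: smooth_map_comp f0s (smooth_map_drop_coord _).
have ac : continuous (@adjoint R m n M).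
  exact: (@initial_continuous _ _ (@adjoint R m n M)).
have split_nbhd (F : Defs.family n M) p s : loopEC n M F -> K p ->
    chart_dom psi (graphing M F p).2 ->
    `|iter_derive_in (@model_dom R m n.+1) s (local_rep phi psi (graphing M F))
        (local_point phi p) -
      iter_derive_in (@model_dom R m n.+1) s (local_rep phi psi f0)
        (local_point phi p)| < e <->
    `|iter_derive_in (@model_dom R m n.+1) s (model_coord (inl ord0))
        (local_point phi p) -
      iter_derive_in (@model_dom R m n.+1) s
        (model_coord (inl ord0) \o local_rep phi psi f0)
        (local_point phi p)| < e /\
    `|iter_derive_in (@model_dom R m n.+1) s (local_rep phi psi (adjoint F))
        (local_point phi p) -
      iter_derive_in (@model_dom R m n.+1) s
        (local_rep phi psi (drop_coord ord0 \o f0)) (local_point phi p)| < e.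
  move=> [Fs _ _] Kp dF; have [dp df0] := Kd p Kp.
  have gs := smooth_map_graph ord0 Fs.
  have fE : @model_coord R n.+1 m (inl ord0) \o local_rep phi psi (graphing M
    F) =
      model_coord (inl ord0).
    by apply/funext => q; exact: insert_coord_same.
  have aE : @drop_coord R n 'rV[R]_m ord0 \o local_rep phi psi (graphing M F) =
      local_rep phi psi (adjoint F).
    apply/funext => q; exact: (add_coordK ord0 (q.1 ord0 ord0)
      (local_rep phi psi (adjoint F) q)).
  have := iter_derive_in_components ord0 s e0 (local_point_dom aphi dp)
    (smooth_local_rep gs aphi apsi dp dF) (smooth_local_rep f0s aphi apsi dp
      df0).
  by rewrite fE aE.
have N1 : N (adjoint F1).
  move=> p Kp; have [dF1 F1d] := NF1 p Kp; split=> // s sr s1.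
  by have /(split_nbhd _ _ _ F1E Kp dF1)[_] := F1d s sr s1.
have : \forall F \near F1, N (adjoint F).
  exact: (ac F1 _ (open_nbhs_nbhs (conj No N1))).
apply: filterS => F NF FE p Kp; have [dF Fd] := NF p Kp.
have [dF1 F1d] := NF1 p Kp; split=> // s sr s1.
apply/(split_nbhd _ _ _ FE Kp dF); split; last exact: Fd.
(* The bound on the t_0-component is the same statement for every loop, so it is taken from F1. *)
by have /(split_nbhd _ _ _ F1E Kp dF1)[] := F1d s sr s1.
Qed.

(* Near the hyperplane where the c-th coordinate is 2, an element of PEC is the
   graph of its projection; so the basic neighbourhood of g0 over K pulls back
   to that of the graph of g0 over the translate {2} x K. *)
Lemma PEC_proj_continuous n (c : 'I_n.+1) :
  {within PEC c M, continuous (PEC_proj c M)}.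
Proof.
apply: within_continuous_weak => N0 f1 [g0 [phi [psi [K [r [e]]]]]].
move=> [g0s [aphi apsi] [Kc e0] Kd ->] f1E Ng1.
pose f0 : weak_map n.+1 n.+1 M := graph_map c (g0 \o drop_coord c).
have f0s : smooth_map f0.
  by apply: smooth_map_graph; exact: smooth_map_comp (smooth_map_drop_coord c)
    g0s.
(* The value 2 is interior to [1, oo): f is a graph on a whole neighbourhood of [K2], so its
   derivatives on [K2] are those of a graph. *)
pose K2 := add_coord c 2 @` K.
pose N := weak_nbhd f0 phi psi K2 r e.
have f0E p : f0 (add_coord c 2 p) = add_coord c 2 (g0 p).
  by rewrite /f0 /graph_map add_coord_fst /= add_coordK.
have No : open N.
  apply: weak_subbase_open; exists f0, phi, psi, K2, r, e; split=> //.
    split=> //; apply: continuous_compact Kc; apply: continuous_subspaceT.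
    by case: (@smooth_map_add_coord R m M n c 2).
  by move=> _ [p Kp <-]; rewrite f0E; exact: Kd.
have split_nbhd f p s : PEC c M f -> K p ->
  chart_dom psi (PEC_proj c M f p).2 ->
    `|iter_derive_in (@model_dom R m n.+1) s (local_rep phi psi f)
        (local_point phi (add_coord c 2 p)) -
      iter_derive_in (@model_dom R m n.+1) s (local_rep phi psi f0)
        (local_point phi (add_coord c 2 p))| < e <->
    `|iter_derive_in (@model_dom R m n) (map (drop_coord c) s)
        (local_rep phi psi (PEC_proj c M f)) (local_point phi p) -
      iter_derive_in (@model_dom R m n) (map (drop_coord c) s)
        (local_rep phi psi g0) (local_point phi p)| < e.
  move=> fE Kp dgp; have [dp dg0] := Kd p Kp; have [_ fg] := PEC_projP fE.
  have fs : smooth_map f by case: fE => -[].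
  have x12 : (1 : R) <= 2 by rewrite ler1n.
  pose x := local_point phi (add_coord c 2 p).
  have dp2 : chart_dom phi (add_coord c 2 p).2 by [].
  have Dx : @model_dom R m n.+1 x := local_point_dom aphi dp2.
  have df2 : chart_dom psi (f (add_coord c 2 p)).2 by rewrite fg.
  have df0 : chart_dom psi (f0 (add_coord c 2 p)).2 by rewrite f0E.
  have fsx := smooth_local_rep fs aphi apsi dp2 df2.
  have f0sx := smooth_local_rep f0s aphi apsi dp2 df0.
  have Da := @model_dom_accessible R n.+1 m.
  pose O := [set q : model n.+1 | 1 < model_coord (inl c) q].
  have Oo : open O.
    apply: (@open_comp _ _ (@model_coord R n.+1 m (inl c)) [set z | 1 < z]).
      by move=> q _; exact: model_coord_continuous.
    exact: open_gt.
  have Ox : O x by rewrite /O /= insert_coord_same ltr1n.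
  pose G : weak_map n.+1 n M := PEC_proj c M f \o drop_coord c.
  have fO q : O q -> local_rep phi psi f q = local_rep phi psi (graph_map c G)
    q.
    move=> Oq; rewrite /local_rep; congr local_point.
    have := fg _ (drop_coord c (q.1, chart_inv phi q.2)) (ltW Oq).
    by rewrite [X in f X](drop_coordK c (q.1, chart_inv phi q.2)).
  have mfO q : O q -> @model_dom R m n.+1 q ->
      (model_coord (inl c) \o local_rep phi psi f) q = model_coord (inl c) q.
    by move=> Oq _; rewrite /comp fO //; exact: insert_coord_same.
  have dfO q : O q -> @model_dom R m n.+1 q ->
      (drop_coord c \o local_rep phi psi f) q =
      (local_rep phi psi (PEC_proj c M f) \o drop_coord c) q.
    move=> Oq _; rewrite /comp fO //.
    exact: (add_coordK c (q.1 ord0 c) (local_rep phi psi G q)).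
  have mf0 : @model_coord R n.+1 m (inl c) \o local_rep phi psi f0 =
      model_coord (inl c).
    by apply/funext => q; exact: insert_coord_same.
  have df0E : @drop_coord R n 'rV[R]_m c \o local_rep phi psi f0 =
      local_rep phi psi g0 \o drop_coord c.
    apply/funext => q; exact: (add_coordK c (q.1 ord0 c)
      (local_rep phi psi (g0 \o drop_coord c) q)).
  have mc := @model_linear_continuous R _ _ _ (@model_coord R n.+1 m (inl c)).
  have dc := @model_linear_continuous R _ _ _ (@drop_coord R n 'rV[R]_m c).
  have mE := iter_derive_in_eqr Da s Oo Ox Dx mfO (smooth_at_linear_comp mc
    fsx).
  have dE := iter_derive_in_eqr Da s Oo Ox Dx dfO (smooth_at_linear_comp dc
    fsx).
  have pre (h : model n -> model n) :
      iter_derive_in (@model_dom R m n.+1) s (h \o drop_coord c) x =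
      iter_derive_in (@model_dom R m n) (map (drop_coord c) s) h
        (local_point phi p).
    rewrite (iter_derive_in_precomp (D' := @model_dom R m n)) //.
    congr (iter_derive_in _ _ _ _).
    exact: (add_coordK c 2 (local_point phi p)).
  (* The c-components of f and [f0] are both the c-th coordinate near x, so their bound reduces to 0
     < e. *)
  have := iter_derive_in_components c s e0 Dx fsx f0sx.
  rewrite mE mf0 dE df0E !pre subrr normr0 => ->.
  by split=> [[]|].
have N1 : N f1.
  move=> _ [p Kp <-]; have [dg gd] := Ng1 p Kp.
  have [_ fg] := PEC_projP f1E.
  split; first by rewrite fg ?ler1n.
  move=> s sr s1; apply/(split_nbhd _ _ _ f1E Kp dg); apply: gd.
    by rewrite size_map.
  rewrite all_map; apply: sub_all s1 => v; exact: drop_coord_norm.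
have : \forall f \near f1, N f by exact: (open_nbhs_nbhs (conj No N1)).
apply: filterS => f Nf fE p Kp; have [_ fg] := PEC_projP fE.
have K2p : K2 (add_coord c 2 p) by exists p.
have [df fd] := Nf _ K2p.
have dg : chart_dom psi (PEC_proj c M f p).2 by move: df; rewrite fg ?ler1n.
split=> // s sr s1.
(* Every list of directions arises by dropping a coordinate; it is lifted with c-th coordinate 0,
   which keeps the vectors in the unit ball. *)
have sE : map (drop_coord c) (map (add_coord c 0) s) = s.
  by rewrite -map_comp map_id_in // => v _; exact: add_coordK.
rewrite -sE; apply/(split_nbhd _ _ _ fE Kp dg); apply: fd.
  by rewrite size_map.
rewrite all_map; apply: sub_all s1 => v; exact: add_coord_norm.
Qed.

End WeakTopology.

(* Here n.+1 is the integer n >= 1 of the fibration. *)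
Theorem proposition4p8 (R : realType) (m n : nat) (M : manifold R m) :
  compact [set: M] ->
  (forall c : 'I_n.+1,
     cubes_map (EC n.+1 M) (concatenation n.+1 M)
               (PEC c M) (PEC_operation c M) id /\
     cubes_map (PEC c M) (PEC_operation c M)
               (EC n M) (kappa c M) (PEC_proj c M)) /\
  cubes_map (loopEC n M) (loop_operation n M)
            (EC n.+1 M) (kappa ord_max M) (graphing M).
Proof.
move=> Mcompact; split=> [c|]; first split.
- split; first by split; [exact: concatenation_action|exact: PEC_action].
  + exact: EC_sub_PEC.
  + by apply: continuous_subspaceT => f; exact: cvg_id.
  + by move=> j L f Ld fE; rewrite image_id (concatenation_PEC c Ld fE).
- split; first by split; [exact: PEC_action|exact: kappa_action].
  + by move=> f /PEC_projP[].
  + exact: PEC_proj_continuous.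
  + by move=> j L f _ fE; exact: PEC_proj_operation.
- split; first by split; [exact: loop_action|exact: kappa_action].
  + by move=> F; exact: graphing_EC.
  + exact: graphing_continuous.
  + by move=> j L F _ _; exact: graphing_operation.
Qed.
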